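(* Let $(\Omega,\mathcal F,P,T)$ be an ergodic probability preserving transformation and let $Y$ be a random variable with values in $\mathbb R_+=(0,\infty)$. Then there exist a $1$-regularly varying, convex function $b:\mathbb R_+\to\mathbb R_+$ and a positive measurable function $f:\Omega\to\mathbb R_+$ such that $$\frac1{b(n)}\sum_{k=0}^{n-1}f\circ T^k\ \longrightarrow\ Y\quad\text{strongly in distribution as } n\to\infty .$$
   Context: $\mathbb R_+=(0,\infty)$. A function $b:\mathbb R_+\to\mathbb R_+$ is $\gamma$-regularly varying if $b(xt)/b(t)\to x^\gamma$ as $t\to\infty$ for every $x>0$; $1$-regularly varying is the case $\gamma=1$. Strong distributional convergence: for a measure space $(X,\mathcal B,m)$, a metric space $Z$, measurable functions $F_n:X\to Z$ and a $Z$-valued random variable $Y$, $F_n$ converges strongly in distribution to $Y$ if for every probability measure $Q$ on $(X,\mathcal B)$ with $Q\ll m$, one has $\int_X g(F_n)\,dQ\to E(g(Y))$ as $n\to\infty$ for every bounded continuous $g:Z\to\mathbb R$. In the claim, the measure space is $(\Omega,\mathcal F,P)$ and $Z=\mathbb R_+$.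
   Formalization: The probability P is additionally assumed nonatomic; without this the claim fails, e.g. on a one-point space, where the normed sums are constants and cannot converge in distribution to a nonconstant Y. *)

(* Defs.v *)
From HB Require Import structures.
From mathcomp Require Import all_boot all_order all_algebra.
From mathcomp Require Import all_classical all_reals all_analysis.

Set Implicit Arguments.
Unset Strict Implicit.
Unset Printing Implicit Defensive.

Import Order.TTheory GRing.Theory Num.Theory.
Import numFieldNormedType.Exports.

Local Open Scope classical_set_scope.
Local Open Scope ring_scope.

(* A function on (0, +oo) is represented by a function on R; its values on
   ]-oo, 0] play no role below. *)
Definition regularly_varying (R : realType) (gamma : R) (b : R -> R) : Prop :=
  forall x : R, 0 < x -> b (x * t) / b t @[t --> +oo] --> x `^ gamma.

Definition measure_preserving d (X : measurableType d) (R : realType)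
    (m : {measure set X -> \bar R}) (T : X -> X) : Prop :=
  measurable_fun [set: X] T /\
  forall A : set X, measurable A -> m (T @^-1` A) = m A.

(* Stated for strictly invariant sets; for a measure-preserving T this is the same
   as asking it of sets that are invariant up to a null set. *)
Definition ergodic d (X : measurableType d) (R : realType)
    (P : probability X R) (T : X -> X) : Prop :=
  forall A : set X, measurable A -> T @^-1` A = A -> P A = 0%E \/ P A = 1%E.

Definition nonatomic d (X : measurableType d) (R : realType)
    (m : {measure set X -> \bar R}) : Prop :=
  forall A : set X, measurable A -> (0 < m A)%E ->
    exists2 B : set X, measurable B /\ B `<=` A & (0 < m B < m A)%E.

(* The target metric space is the subspace D of Z. Bounded continuous real
   functions on D are represented by functions on Z that are bounded on D and
   continuous for the subspace topology of D; as F n (for n large) and Y take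
   their values in D, what such a function does outside D is irrelevant. *)
Definition strongly_cvg_in_distribution d (X : measurableType d) (R : realType)
    (m : {measure set X -> \bar R}) (Z : metricType R) (D : set Z)
    (F : nat -> X -> Z)
    d' (X' : measurableType d') (P' : probability X' R) (Y : X' -> Z) : Prop :=
  forall Q : probability X R, Q `<< m ->
  forall g : Z -> R, {within D, continuous g} -> [bounded g z | z in D] ->
    (\int[Q]_x (g (F n x))%:E)%E @[n --> \oo] --> ('E_P'[g \o Y])%E.

(* Main.v *)
Require Import Defs.
From HB Require Import structures.
From mathcomp Require Import all_boot all_order all_algebra.
From mathcomp Require Import all_classical all_reals all_analysis.
From mathcomp Require Import measurable_realfun.
From mathcomp Require Import zify ring lra.

Set Implicit Arguments.
Unset Strict Implicit.
Unset Printing Implicit Defensive.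

Import Order.TTheory GRing.Theory Num.Theory.
Import numFieldNormedType.Exports.

Local Open Scope classical_set_scope.
Local Open Scope ring_scope.

(* The function f is a series of nonnegative functions, the j-th one being equal to
   K_j Y_j on a set that orbits visit about once every K_j = 2^(j^2) steps and to 0
   elsewhere. When K_k <= n < K_(k+1), an orbit of length n visits the j-th set about
   n / K_j times if j < k and typically never if j > k, so that the ergodic sum of f
   is about n (Y_0 + ... + Y_(k-1)) if the Y_j hardly vary along the orbit; the
   convex norming function t + sum_j (t - K_j)^+ is then about n k.

   The Y_j come from a renewal structure. There are almost invariant variables
   V_0, V_1, ..., each almost independent of the previous ones; with probability
   1/(i+1), V_i declares a renewal and carries a fresh copy of Y (discretised and
   truncated). The q-th renewal value is the one carried by the first renewal at or
   after step q. It has almost the law of Y, it is as invariant as V_q, and it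
   changes from q to q+1 with probability 1/(q+1) only. Taking for Y_j the renewal
   value of index log log j, the terms Y_j with j >= sqrt k, which dominate the
   sum, all coincide with the current value with high probability.

   Almost invariant variables are obtained by reading the hitting time of a very
   small set modulo a large number, and by the mean ergodic theorem an almost
   invariant variable is almost independent of any given set. This last fact also
   turns convergence under P into convergence under every Q << P. *)

(** * Probabilities and means of bounded functions *)

Section expectation.
Context d (X : measurableType d) (R : realType) (P : probability X R).
Implicit Types (A B : set X) (f g : X -> R).

(** By ergodicity an invariant function is almost surely constant, so the randomness of the limit
    must come from variables that are invariant only up to some time, and these have to be replaced
    as [n] grows. If every level of the series carried its own independent copy of an integrable
    [Y], the average of [k] copies would obey a law of large numbers and the limit would be a
    constant. The levels must therefore share one value most of the time, while this value is
    renewed infinitely often. The harmonic rate [1 / (i+1)] reconciles the two: its sum diverges, so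
    a renewal always comes, yet the rate tends to 0, so a change at a given stage is unlikely. The
    double logarithm adapts this to the series: the levels from [sqrt k] to [k] belong to at most
    two consecutive stages, and the lower ones are too few to count. The exceptional events at stage
    [q] have probability of order [1 / q] only, which is enough for convergence in distribution. *)

Definition prob A : R := fine (P A).

Definition bdd_meas f := measurable_fun [set: X] f /\ exists C : R, forall x, `|f x| <= C.

Definition mean f : R := \int[P]_x f x.

Local Notation pr := prob.
Local Notation expect := mean.

Lemma prE A : measurable A -> P A = (pr A)%:E.
Proof. by move=> mA; rewrite /pr fineK// fin_num_measure. Qed.

Lemma pr_ge0 A : 0 <= pr A.
Proof. exact: fine_ge0. Qed.

Lemma pr_setT : pr setT = 1.
Proof. by rewrite /pr probability_setT. Qed.

Lemma pr_set0 : pr set0 = 0.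
Proof. by rewrite /pr measure0. Qed.

Lemma le_pr A B : measurable A -> measurable B -> A `<=` B -> pr A <= pr B.
Proof.
move=> mA mB AB; rewrite -lee_fin -!prE//.
by apply: le_measure => //; rewrite inE.
Qed.

Lemma pr_le1 A : measurable A -> pr A <= 1.
Proof. by move=> mA; rewrite -lee_fin -prE// probability_le1. Qed.

Lemma prU A B : measurable A -> measurable B -> [disjoint A & B]%classic ->
  pr (A `|` B) = pr A + pr B.
Proof.
move=> mA mB AB; apply/EFin_inj; rewrite EFinD -!prE//; last exact: measurableU.
by rewrite measureU//; exact/eqP.
Qed.

Lemma prU_le A B : measurable A -> measurable B -> pr (A `|` B) <= pr A + pr B.
Proof.
move=> mA mB; rewrite -lee_fin EFinD -!prE//; last exact: measurableU.
exact: measureU2.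
Qed.

Lemma prC A : measurable A -> pr (~` A) = 1 - pr A.
Proof.
move=> mA; apply/EFin_inj; rewrite EFinB -!prE//; last exact: measurableC.
exact: probability_setC.
Qed.

Lemma pr_bigU_le n (F : nat -> set X) (a : nat -> R) :
  (forall i, (i < n)%N -> measurable (F i)) ->
  (forall i, (i < n)%N -> pr (F i) <= a i) ->
  pr (\bigcup_(i < n) F i) <= \sum_(0 <= i < n) a i.
Proof.
elim: n => [_ _|n IH mF Fa].
  by rewrite II0 bigcup_set0 pr_set0 big_geq.
rewrite IIS bigcup_setU bigcup_set1 big_nat_recr//=.
apply: le_trans (prU_le _ _) _.
- by apply: bigcup_measurable => i /= /ltnW; rewrite -ltnS => /mF; apply.
- exact: mF.
- apply: lerD; last exact: Fa.
  by apply: IH => i /ltnW; rewrite -ltnS; [exact: mF|exact: Fa].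
Qed.

(** Quantitative Borel-Cantelli: it discards at one stroke all the exceptional events of index at
    least [m]. *)
Lemma pr_bigcup_pow2 m (F : nat -> set X) (c : R) : 0 <= c ->
  (forall i, measurable (F i)) ->
  (forall i, (m <= i)%N -> pr (F i) <= c * 2^-1 ^+ i) ->
  pr (\bigcup_(i in [set i | (m <= i)%N]) F i) <= c * 2 * 2^-1 ^+ m.
Proof.
move=> c0 mF Fa.
have -> : \bigcup_(i in [set i | (m <= i)%N]) F i = \bigcup_i F (i + m)%N.
  apply/seteqP; split => x /= [i].
    by move=> /= mi Fx; exists (i - m)%N => //; rewrite subnK.
  by move=> _ Fx; exists (i + m)%N => //=; rewrite leq_addl.
have mU : measurable (\bigcup_i F (i + m)%N) by exact: bigcup_measurable.
rewrite -lee_fin -prE//.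
apply: (@le_trans _ _ (\sum_(0 <= i <oo) P (F (i + m)%N))%E).
  by apply: measure_sigma_subadditive => // i; exact: mF.
have cvS : (\sum_(0 <= i < n) (c * 2^-1 ^+ m)%:E * (2^-1 ^+ i)%:E @[n --> \oo]
    --> (c * 2^-1 ^+ m * 2)%:E)%E.
  under eq_fun do (under eq_bigr do rewrite -EFinM; rewrite sumEFin -mulr_sumr).
  apply: cvg_EFin; first by near=> n.
  rewrite /comp/=; apply: cvgMr.
  have := @cvg_geometric_series R 1 2^-1.
  rewrite ger0_norm// invf_lt1// ltr1n => /(_ isT).
  rewrite (_ : 1 / (1 - 2^-1) = 2 :> R); last by field.
  apply: cvg_trans; apply: near_eq_cvg; near=> n => /=.
  by rewrite /series/=; apply: eq_bigr => i _; rewrite mul1r.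
rewrite [leRHS](_ : _ = (\sum_(0 <= i <oo) (c * 2^-1 ^+ m)%:E * (2^-1 ^+ i)%:E)%E); last first.
  by rewrite (cvg_lim _ cvS)//; congr EFin; ring.
apply: lee_nneseries => // i _.
rewrite /= prE// -EFinM lee_fin.
by apply: le_trans (Fa _ (leq_addl _ _)) _; rewrite exprD; lra.
Unshelve. all: by end_near. Qed.

Lemma pr_bigcap_approx (F : nat -> set X) (e : R) : 0 < e ->
  (forall i, measurable (F i)) -> (forall i, F i.+1 `<=` F i) ->
  exists n, pr (F n) < pr (\bigcap_i F i) + e.
Proof.
move=> e0 mF dF.
have mI : measurable (\bigcap_i F i) by exact: bigcapT_measurable.
have cv : P \o F @ \oo --> P (\bigcap_i F i).
  apply: nonincreasing_cvg_mu => //.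
    by rewrite (le_lt_trans (probability_le1 P (mF 0%N)))// ltry.
  by apply/nonincreasing_seqP => n; apply/subsetPset/dF.
have [n _ nP] : \forall n \near \oo, pr (F n) < pr (\bigcap_i F i) + e.
  move: cv; rewrite prE// => /fine_cvg/cvgrPdist_lt/(_ _ e0); apply: filterS => n.
  by rewrite distrC => /(le_lt_trans (ler_norm _)); rewrite ltrBlDl.
by exists n; exact: nP (leqnn n).
Qed.

(** * Bounded measurable functions and their means *)

Lemma bdd_measW f : bdd_meas f -> P.-integrable setT (EFin \o f).
Proof.
move=> [mf [C fC]]; apply: measurable_bounded_integrable => //.
  by rewrite (le_lt_trans (probability_le1 P measurableT))// ltry.
exists C; split; first exact: num_real.
by move=> y Cy x _; apply: le_trans (fC x) (ltW Cy).
Qed.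

Lemma bdd_meas_cst (c : R) : bdd_meas (fun=> c).
Proof. by split=> //; exists `|c|. Qed.

Lemma bdd_measD f g : bdd_meas f -> bdd_meas g -> bdd_meas (fun x => f x + g x).
Proof.
move=> [mf [C fC]] [mg [D gD]]; split; first exact: measurable_funD.
by exists (C + D) => x; rewrite (le_trans (ler_normD _ _))// lerD.
Qed.

Lemma bdd_measM f g : bdd_meas f -> bdd_meas g -> bdd_meas (fun x => f x * g x).
Proof.
move=> [mf [C fC]] [mg [D gD]]; split; first exact: measurable_funM.
by exists (C * D) => x; rewrite normrM ler_pM.
Qed.

Lemma bdd_measZ (c : R) f : bdd_meas f -> bdd_meas (fun x => c * f x).
Proof. by apply: bdd_measM; exact: bdd_meas_cst. Qed.

Lemma bdd_measB f g : bdd_meas f -> bdd_meas g -> bdd_meas (fun x => f x - g x).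
Proof.
move=> mf mg; rewrite (_ : (fun x => _) = (fun x => f x + (-1) * g x)).
  by apply: bdd_measD => //; exact: bdd_measZ.
by apply/funext => x; rewrite mulN1r.
Qed.

Lemma bdd_meas_norm f : bdd_meas f -> bdd_meas (fun x => `|f x|).
Proof.
move=> [mf [C fC]]; split; first exact: measurableT_comp.
by exists C => x; rewrite normr_id.
Qed.

Lemma bdd_meas_indic A : measurable A -> bdd_meas (\1_A : X -> R).
Proof.
move=> mA; split; first exact: measurable_indic.
by exists 1 => x; rewrite indicE; case: (_ \in _); rewrite ?normr1 ?normr0.
Qed.

Lemma bdd_meas_sum m n (F : nat -> X -> R) :
  (forall i, (m <= i < n)%N -> bdd_meas (F i)) ->
  bdd_meas (fun x => \sum_(m <= i < n) F i x).
Proof.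
elim: n => [|n IH] mF.
  by under eq_fun do rewrite big_geq//; exact: bdd_meas_cst.
have [mn|nm] := leqP m n; last first.
  by under eq_fun do rewrite big_geq//; exact: bdd_meas_cst.
under eq_fun do rewrite big_nat_recr//=.
apply: bdd_measD; last by apply: mF; rewrite mn ltnSn.
by apply: IH => i /andP[mi ni]; apply: mF; rewrite mi ltnW.
Qed.

Lemma bdd_meas_comp (T : X -> X) f : measurable_fun [set: X] T ->
  bdd_meas f -> bdd_meas (fun x => f (T x)).
Proof.
move=> mT [mf [C fC]]; split; first exact: (measurableT_comp mf mT).
by exists C => x; exact: fC.
Qed.

Lemma expect_cst (c : R) : expect (fun=> c) = c.
Proof.
by rewrite /expect Rintegral_cst//= probability_setT/= mulr1.
Qed.

Lemma expectD f g : bdd_meas f -> bdd_meas g ->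
  expect (fun x => f x + g x) = expect f + expect g.
Proof. by move=> mf mg; rewrite /expect RintegralD//; exact: bdd_measW. Qed.

Lemma expectZ (c : R) f : bdd_meas f -> expect (fun x => c * f x) = c * expect f.
Proof. by move=> mf; rewrite /expect RintegralZl//; exact: bdd_measW. Qed.

Lemma expectB f g : bdd_meas f -> bdd_meas g ->
  expect (fun x => f x - g x) = expect f - expect g.
Proof. by move=> mf mg; rewrite /expect RintegralB//; exact: bdd_measW. Qed.

Lemma expect_sum m n (F : nat -> X -> R) :
  (forall i, (m <= i < n)%N -> bdd_meas (F i)) ->
  expect (fun x => \sum_(m <= i < n) F i x) = \sum_(m <= i < n) expect (F i).
Proof.
elim: n => [|n IH] mF.
  by under [in LHS]eq_fun do rewrite big_geq//; rewrite expect_cst big_geq.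
have [mn|nm] := leqP m n; last first.
  by under [in LHS]eq_fun do rewrite big_geq//; rewrite expect_cst big_geq.
under [in LHS]eq_fun do rewrite big_nat_recr//=.
rewrite expectD; last by apply: mF; rewrite mn ltnSn.
  rewrite big_nat_recr//= IH// => i /andP[mi ni]; apply: mF; rewrite mi ltnW//.
by apply: bdd_meas_sum => i /andP[mi ni]; apply: mF; rewrite mi ltnW.
Qed.

Lemma le_expect f g : bdd_meas f -> bdd_meas g -> (forall x, f x <= g x) ->
  expect f <= expect g.
Proof.
by move=> mf mg fg; rewrite /expect le_Rintegral//; exact: bdd_measW.
Qed.

Lemma expect_ge0 f : (forall x, 0 <= f x) -> 0 <= expect f.
Proof. by move=> f0; apply: Rintegral_ge0 => x _; exact: f0. Qed.

Lemma le_norm_expect f : bdd_meas f -> `|expect f| <= expect (fun x => `|f x|).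
Proof. by move=> mf; apply: le_normr_Rintegral => //; exact: bdd_measW. Qed.

Lemma expect_indic A : measurable A -> expect (\1_A : X -> R) = pr A.
Proof.
by move=> mA; rewrite /expect /Rintegral integral_indic// setIT.
Qed.

Lemma norm_expectM_le f g (C : R) : bdd_meas f -> bdd_meas g ->
  (forall x, `|f x| <= C) -> `|expect (fun x => f x * g x)| <= C * expect (fun x => `|g x|).
Proof.
move=> mf mg fC; rewrite -expectZ; last exact: bdd_meas_norm.
apply: le_trans (le_norm_expect (bdd_measM mf mg)) _.
apply: le_expect => [||x].
- exact: bdd_meas_norm (bdd_measM mf mg).
- exact: bdd_measZ (bdd_meas_norm mg).
- by rewrite normrM ler_wpM2r.
Qed.

Lemma expect_le_good f A (e C : R) : 0 <= e -> 0 <= C -> bdd_meas f -> measurable A ->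
  (forall x, A x -> f x <= e) -> (forall x, f x <= C) ->
  expect f <= e + C * pr (~` A).
Proof.
move=> e0 C0 mf mA fe fC; rewrite -expect_indic; last exact: measurableC.
rewrite -[e in leRHS]expect_cst -expectZ; last exact/bdd_meas_indic/measurableC.
have mI : bdd_meas (fun x => C * \1_(~` A) x : R).
  exact/bdd_measZ/bdd_meas_indic/measurableC.
rewrite -expectD//; last exact: bdd_meas_cst.
apply: le_expect => [//||x]; first by apply: bdd_measD => //; exact: bdd_meas_cst.
rewrite indicE in_setC; case: (boolP (x \in A)) => [/[!inE] Ax|_] /=.
  by rewrite mulr0 addr0 fe.
by rewrite mulr1 (le_trans (fC x))// lerDr.
Qed.

(** * Variables with values in [nat] *)

Lemma measurable_nat2 (r s : X -> nat) (Q : nat -> nat -> Prop) :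
  measurable_fun setT r -> measurable_fun setT s -> measurable [set x | Q (r x) (s x)].
Proof.
move=> mr ms.
rewrite (_ : [set x | _] =
  \bigcup_i \bigcup_j ((r @^-1` [set i]) `&` (s @^-1` [set j]) `&` [set x | Q i j])).
  apply: bigcup_measurable => i _; apply: bigcup_measurable => j _.
  apply: measurableI; first apply: measurableI.
  - by rewrite -[X in measurable X]setTI; exact: mr.
  - by rewrite -[X in measurable X]setTI; exact: ms.
  - have [q|nq] := pselect (Q i j).
      by rewrite (_ : [set _ | _] = setT)//; apply/seteqP; split.
    by rewrite (_ : [set _ | _] = set0)//; apply/seteqP; split.
apply/seteqP; split => x /=.
  by move=> q; exists (r x) => //; exists (s x) => //.
by move=> [i _ [j _ [[/= -> ->]]]].
Qed.

Lemma measurable_nat1 (r : X -> nat) (Q : nat -> Prop) :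
  measurable_fun setT r -> measurable [set x | Q (r x)].
Proof. by move=> mr; exact: (@measurable_nat2 r r (fun a _ => Q a)). Qed.

Lemma measurable_fun_natR (r : X -> nat) (phi : nat -> R) :
  measurable_fun setT r -> measurable_fun setT (fun x => phi (r x)).
Proof.
move=> mr _ B mB; rewrite setTI.
exact: (@measurable_nat1 r (fun i => B (phi i))).
Qed.

Lemma measurable_fun_natP (r : X -> nat) :
  (forall i, measurable (r @^-1` [set i])) -> measurable_fun setT r.
Proof.
move=> mr _ B _; rewrite setTI (_ : _ @^-1` _ = \bigcup_(i in B) (r @^-1` [set i])).
  by apply: bigcup_measurable => i _; exact: mr.
by apply/seteqP; split => x /= => [Bx|[i Bi /= ->]//]; exists (r x).
Qed.

Lemma pr_bigcupI n (V : X -> nat) A : measurable A -> measurable_fun setT V ->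
  pr (A `&` [set x | (V x < n)%N]) = \sum_(0 <= v < n) pr (A `&` [set x | V x = v]).
Proof.
move=> mA mV; elim: n => [|n IH].
  by rewrite big_geq// (_ : _ `&` _ = set0) ?pr_set0//; apply/seteqP; split => x //= [].
rewrite big_nat_recr//= -IH -prU.
- congr pr; apply/seteqP; split => x /=.
    by case=> Ax; rewrite ltnS leq_eqVlt => /orP[/eqP|]; [right|left].
  by case=> -[Ax]; [move=> /ltnW; split|move=> ->; split].
- by apply: measurableI => //; exact: (measurable_nat1 (fun m => (m < n)%N) mV).
- by apply: measurableI => //; exact: (measurable_nat1 (fun m => m = n) mV).
- by apply/eqP/seteqP; split => x //= -[[_ h1] [_ h2]]; move: h1; rewrite h2 ltnn.
Qed.

Lemma expect_natfunI n (V : X -> nat) A (phi : nat -> R) : measurable A ->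
  measurable_fun setT V -> (forall x, (V x < n)%N) ->
  expect (fun x => \1_A x * phi (V x)) =
  \sum_(0 <= v < n) phi v * pr (A `&` [set x | V x = v]).
Proof.
move=> mA mV Vn.
have mI v : measurable (A `&` [set x | V x = v]).
  by apply: measurableI => //; exact: (measurable_nat1 (fun i => i = v)).
have bI v : bdd_meas (fun x => phi v * \1_(A `&` [set x | V x = v]) x : R).
  exact/bdd_measZ/bdd_meas_indic.
transitivity (expect (fun x => \sum_(0 <= v < n) phi v * \1_(A `&` [set x | V x = v]) x)).
  congr expect; apply/funext => x.
  rewrite (bigD1_seq (V x))/= ?mem_index_iota ?iota_uniq//=.
  rewrite big1 ?addr0 => [|v vV].
    rewrite mulrC indicE indicE; congr (_ * (nat_of_bool _)%:R).
    by apply/idP/idP => [/set_mem Ax|/set_mem[Ax _]]; exact/mem_set.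
  by rewrite indicE memNset ?mulr0// => -[_ /= h]; rewrite h eqxx in vV.
rewrite expect_sum//; apply: eq_bigr => v _.
by rewrite expectZ ?expect_indic//; exact: bdd_meas_indic.
Qed.

End expectation.

(** * Hitting times *)

Section hitting_times.
Context d (X : measurableType d) (R : realType) (P : probability X R) (T : X -> X).
Hypothesis T_mp : measure_preserving P T.
Implicit Types (A : set X) (f u q : X -> R).
Local Notation pr := (prob P).
Local Notation expect := (mean P).

Let mT : measurable_fun [set: X] T. Proof. by case: T_mp. Qed.

Lemma measurable_iter n : measurable_fun [set: X] (iter n T).
Proof.
elim: n => [|n IH]; first exact: measurable_id.
by rewrite (_ : iter n.+1 T = T \o iter n T)//; exact: measurableT_comp.
Qed.

Lemma measurable_iter_preimage n A : measurable A -> measurable (iter n T @^-1` A).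
Proof. by move=> mA; rewrite -[X in measurable X]setTI; exact: measurable_iter. Qed.

Lemma pr_iter n A : measurable A -> pr (iter n T @^-1` A) = pr A.
Proof.
move=> mA; elim: n => // n IH.
rewrite -IH (_ : iter n.+1 T @^-1` A = T @^-1` (iter n T @^-1` A)).
  by rewrite /prob (proj2 T_mp)//; exact: measurable_iter_preimage.
by apply/seteqP; split => x; rewrite /preimage/= -iterSr.
Qed.

Lemma expect_comp f : bdd_meas f -> expect (fun x => f (T x)) = expect f.
Proof.
move=> bf; have [mf _] := bf.
rewrite /mean /Rintegral.
transitivity (fine (\int[P]_(x in T @^-1` setT) ((EFin \o f) \o T) x)%E).
  by rewrite preimage_setT.
rewrite -integral_pushforward//.
- congr fine; apply: eq_measure_integral => A mA _.
  exact: (proj2 T_mp).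
- exact/measurable_EFinP.
- by rewrite preimage_setT; exact/bdd_measW/bdd_meas_comp.
Qed.

Lemma bdd_meas_iter n f : bdd_meas f -> bdd_meas (fun x => f (iter n T x)).
Proof. by apply: bdd_meas_comp; exact: measurable_iter. Qed.

Lemma expect_iter n f : bdd_meas f -> expect (fun x => f (iter n T x)) = expect f.
Proof.
move=> bf; elim: n => // n IH.
by rewrite -IH -[RHS]expect_comp; [under eq_fun do rewrite iterSr|exact: bdd_meas_iter].
Qed.

Hypothesis T_erg : ergodic P T.

(* [ergodic] only speaks of strictly invariant sets: pass to the intersection of
   the preimages of the set of points that visit A. *)
Lemma ergodic_visit A : measurable A -> 0 < pr A ->
  pr [set x | forall n, ~ A (iter n T x)] = 0.
Proof.
move=> mA A0.
pose G := \bigcup_n (iter n T @^-1` A).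
have mG : measurable G by apply: bigcup_measurable => n _; exact: measurable_iter_preimage.
pose F i := iter i T @^-1` G.
have mF i : measurable (F i) by exact: measurable_iter_preimage.
have dF i : F i.+1 `<=` F i.
  move=> x [n _ /= xn]; exists n.+1 => //=.
  by rewrite -iterS -iterD addSn -addnS iterD.
have mI : measurable (\bigcap_i F i) by exact: bigcapT_measurable.
have inv : T @^-1` (\bigcap_i F i) = \bigcap_i F i.
  apply/seteqP; split => x /= Fx i _.
    by apply: dF; have := Fx i I; rewrite /F /= -iterSr.
  by have := Fx i.+1 I; rewrite /F /= -iterSr.
(* The [F i] decrease and all have the probability of [G], hence so does their intersection, which,
   unlike [G] in general, is strictly invariant. *)
have prI : pr (\bigcap_i F i) = pr G.
  apply/eqP; rewrite eq_le; apply/andP; split.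
    by apply: le_pr => // x /(_ 0%N I).
  apply/ler_addgt0Pr => e e0.
  have [n] := pr_bigcap_approx P e0 mF dF.
  by rewrite pr_iter// => /ltW.
have G1 : pr G = 1.
  have AG : pr A <= pr G by apply: le_pr => // x Ax; exists 0%N.
  have [] := T_erg mI inv; rewrite prE// prI => -[] // G0; move: AG.
  by rewrite G0 leNgt A0.
rewrite (_ : [set x | _] = ~` G).
  by rewrite prC// G1 subrr.
apply/seteqP; split => x /=.
  by move=> nA [n _ /= An]; exact: nA An.
by move=> nG n An; apply: nG; exists n.
Qed.

(** Repeated bisection: when a set is split into two parts of positive probability, one of them has
    at most half of its probability. *)
Lemma small_set (P_na : nonatomic P) (e : R) : 0 < e ->
  exists A, [/\ measurable A, 0 < pr A & pr A < e].
Proof.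
move=> e0.
have H n : exists A, [/\ measurable A, 0 < pr A & pr A <= 2^-1 ^+ n].
  elim: n => [|n [A [mA A0 An]]].
    by exists setT; split => //; rewrite pr_setT.
  have PA0 : (0 < P A)%E by rewrite prE// lte_fin.
  have [B [mB BA]] := P_na A mA PA0.
  have -> : (0 < P B < P A)%E = (0 < pr B < pr A) by rewrite -!lte_fin -!prE.
  move=> /andP[B0 BlA].
  have mAB : measurable (A `\` B) by exact: measurableD.
  have eAB : pr A = pr B + pr (A `\` B).
    rewrite -prU//; last by apply/eqP/seteqP; split => x //= [? [? ]].
    by rewrite setDUK.
  have hn : 2^-1 ^+ n = 2^-1 ^+ n.+1 * 2 :> R by rewrite exprS; field.
  have [hB|hB] := lerP (pr B) (2^-1 ^+ n.+1).
    by exists B.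
  exists (A `\` B); split => //; lra.
have : (2^-1 ^+ n : R) @[n --> \oo] --> (0:R).
  by apply: cvg_expr; rewrite ger0_norm// invf_lt1// ltr1n.
move=> /cvgrPdist_lt/(_ _ e0)[n _ /(_ n (leqnn n))].
rewrite /= sub0r normrN ger0_norm ?exprn_ge0// => ne.
by have [A [mA A0 An]] := H n; exists A; split => //; exact: le_lt_trans An ne.
Qed.

(** [r] is the first time at which the orbit is in a small set. It is 0 on the set itself and, by
    convention, on the orbits that never reach it; by ergodicity the latter form a null set, so
    [r = 0] stays unlikely. *)
Lemma hitting_time (P_na : nonatomic P) (e : R) : 0 < e ->
  exists r : X -> nat, [/\ measurable_fun [set: X] r,
    (forall x, (0 < r x)%N -> r (T x) = (r x).-1) &
    pr [set x | r x = 0%N] <= e].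
Proof.
move=> e0.
have [A [mA A0 Ae]] := small_set P_na e0.
pose ev x := exists n, iter n T x \in A.
pose r x := if pselect (ev x) is left h then ex_minn h else 0%N.
have rP x n : r x = n.+1 <->
    A (iter n.+1 T x) /\ forall i, (i <= n)%N -> ~ A (iter i T x).
  rewrite /r; case: pselect => [h|nh]; last first.
    split => // -[An _]; case: nh; exists n.+1; exact/mem_set.
  case: ex_minnP => m /set_mem mA' mmin; split => [mn|[An nA]].
    subst m; split => // i ni Ai.
    by have := mmin i (mem_set Ai); rewrite leqNgt ltnS ni.
  apply/eqP; rewrite eqn_leq mmin ?mem_set//= ltnNge; apply/negP => mn.
  exact: nA mA'.
have r0 : [set x | r x = 0%N] = A `|` [set x | forall n, ~ A (iter n T x)].
  apply/seteqP; split => x /=.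
    rewrite /r; case: pselect => [h|nh _].
      by case: ex_minnP => m mA' _ m0; left; subst m; exact/set_mem.
    by right => n An; apply: nh; exists n; exact/mem_set.
  case: (r x) (rP x) => // n /(_ n)[/(_ erefl)[An nA] _] [Ax|/(_ _ An)//].
  by case: (nA 0%N).
have mnever : measurable [set x | forall n, ~ A (iter n T x)].
  rewrite (_ : [set x | _] = \bigcap_n (iter n T @^-1` (~` A))).
    apply: bigcapT_measurable => n.
    by apply: measurable_iter_preimage; exact: measurableC.
  by apply/seteqP; split => x /= h n; [move=> _|]; exact: h.
exists r; split.
- apply: measurable_fun_natP => -[|n].
    by rewrite (_ : _ @^-1` _ = [set x | r x = 0%N])// r0; exact: measurableU.
  rewrite (_ : _ @^-1` _ =
      (iter n.+1 T @^-1` A) `&` \bigcap_(i in `I_n.+1) (iter i T @^-1` (~` A))).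
    apply: measurableI; first exact: measurable_iter_preimage.
    apply: bigcap_measurable; first by exists 0%N.
    by move=> i _; apply: measurable_iter_preimage; exact: measurableC.
  by apply/seteqP; split => x /=; rewrite rP => -[An nA]; split.
- move=> x; case: (r x) (rP x) => // n /(_ n)[/(_ erefl)[An nA] _] _ /=.
  case: n An nA => [|n] An nA.
    have : [set x | r x = 0%N] (T x) by rewrite r0; left.
    by [].
  apply/rP; split; first by rewrite -iterSr.
  by move=> i ni; rewrite -iterSr; exact: nA.
- rewrite r0; apply: le_trans (prU_le _ _ _) _ => //.
  by rewrite ergodic_visit// addr0 ltW.
Qed.

(** * Functions that decrease by 1 along orbits until they reach 0 *)

Section countdown.
Variables (r : X -> nat) (e : R).
Hypotheses (mr : measurable_fun [set: X] r)
  (rT : forall x, (0 < r x)%N -> r (T x) = (r x).-1)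
  (r0 : pr [set x | r x = 0%N] <= e).

Lemma countdown_iter x i : (i <= r x)%N -> r (iter i T x) = (r x - i)%N.
Proof.
elim: i => [|i IH] ir; first by rewrite subn0.
by rewrite iterS rT IH ?(ltnW ir)// ?subn_gt0// subnS.
Qed.

(** [r x < n] forces a visit to [r = 0] during the first [n] steps, and each step contributes at
    most [e]. *)
Lemma pr_countdown_lt n : pr [set x | (r x < n)%N] <= n%:R * e.
Proof.
have mr0 : measurable [set x | r x = 0%N] by exact: (measurable_nat1 (fun i => i = 0%N)).
have mF i : measurable (iter i T @^-1` [set x | r x = 0%N]).
  exact: measurable_iter_preimage.
have mU : measurable (\bigcup_(i < n) iter i T @^-1` [set x | r x = 0%N]).
  by apply: bigcup_measurable => i _; exact: mF.
have -> : n%:R * e = \sum_(0 <= i < n) e.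
  by rewrite big_const_nat subn0 iter_addr_0 mulr_natl.
apply: le_trans (pr_bigU_le (F := fun i => iter i T @^-1` [set x | r x = 0%N]) _ _).
- apply: le_pr => //; first exact: (measurable_nat1 (fun i => (i < n)%N)).
  by move=> x /= rn; exists (r x) => //=; rewrite countdown_iter// subnn.
- by move=> i _; exact: mF.
- by move=> i _; rewrite pr_iter.
Qed.

(** [T] sends the residue [i.+1] to the residue [i], so the probabilities of the residues decrease
    with [i]; off [r = 0] it sends the residue 0 to [m.-1], so the largest exceeds the smallest by
    at most [e]. All of them, and their average [1 / m], lie in an interval of length at most
    [e]. *)
Lemma pr_countdown_mod m c : (c < m)%N ->
  `|pr [set x | (r x %% m)%N = c] - m%:R^-1| <= e.
Proof.
move=> cm; have m0 : (0 < m)%N by exact: leq_ltn_trans cm.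
pose p i := pr [set x | (r x %% m)%N = i].
have mp (Q : nat -> Prop) : measurable [set x | Q (r x)] by exact: measurable_nat1.
have e0 : 0 <= e by rewrite (le_trans _ r0)// pr_ge0.
have pS i : (i.+1 < m)%N -> p i.+1 <= p i.
  move=> im; rewrite {2}/p -(pr_iter 1); last exact: (mp (fun j => (j %% m)%N = i)).
  apply: le_pr; first exact: (mp (fun j => (j %% m)%N = i.+1)).
    by apply: measurable_iter_preimage; exact: (mp (fun j => (j %% m)%N = i)).
  move=> x /= xi; have r0' : (0 < r x)%N by case: (r x) xi => //; rewrite mod0n.
  rewrite rT//; move: xi r0'; case: (r x) => // j /= + _.
  by rewrite modnS; case: ifP => // _ [].
have p_dec i j : (i <= j < m)%N -> p j <= p i.
  elim: j => [|j IH]; first by rewrite leqn0 => /andP[/eqP->].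
  move=> /andP[]; rewrite leq_eqVlt => /orP[/eqP->//|ij] jm.
  by apply: le_trans (pS _ jm) _; apply: IH; rewrite -ltnS ij ltnW.
have p0 : p 0%N <= p m.-1 + e.
  have -> : p 0%N = pr [set x | r x = 0%N] +
      pr [set x | (r x %% m)%N = 0%N /\ r x <> 0%N].
    rewrite -prU.
    - congr pr; apply/seteqP; split => x /=.
        by move=> h; have [->|/eqP] := eqVneq (r x) 0%N; [left|right].
      by move=> [->|[]//]; rewrite mod0n.
    - exact: (mp (fun j => j = 0%N)).
    - exact: (mp (fun j => (j %% m)%N = 0%N /\ j <> 0%N)).
    - by apply/eqP/seteqP; split => x //= [-> []].
  rewrite addrC lerD// /p -(pr_iter 1 (A := [set x | (r x %% m)%N = m.-1])); last exact: (mp (fun j => (j %% m)%N = m.-1)).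
  apply: le_pr; first exact: (mp (fun j => (j %% m)%N = 0%N /\ j <> 0%N)).
    by apply: measurable_iter_preimage; exact: (mp (fun j => (j %% m)%N = m.-1)).
  move=> x /= [xi /eqP]; rewrite -lt0n => r0'; rewrite rT//.
  move: xi r0'; case: (r x) => // j /= + _.
  rewrite modnS; case: ifP => // /dvdnP[[//|k]] jk _.
  rewrite (_ : j = k * m + m.-1)%N ?modnMDl ?modn_small ?prednK//.
  by move: jk; rewrite mulSn; lia.
have sump : \sum_(0 <= i < m) p i = 1.
  have := pr_bigcupI P m (A := setT) (V := fun x => (r x %% m)%N) measurableT.
  rewrite (_ : setT `&` _ = setT); last first.
    by apply/seteqP; split => x //= _; split => //; exact: ltn_pmod.
  rewrite pr_setT => -> //; first by apply: eq_bigr => i _; rewrite setTI.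
  by apply: measurable_fun_natP => i; exact: (mp (fun j => (j %% m)%N = i)).
have mR : (0 : R) < m%:R by rewrite ltr0n.
have up (a : R) : (forall i, (i < m)%N -> p i <= a) -> m%:R^-1 <= a.
  move=> pa; rewrite -div1r ler_pdivrMr// -{1}sump.
  have -> : a * m%:R = \sum_(0 <= i < m) a.
    by rewrite big_const_nat subn0 iter_addr_0 mulr_natr.
  by rewrite big_nat [leRHS]big_nat; apply: ler_sum => i /andP[_ im]; exact: pa.
have lo (a : R) : (forall i, (i < m)%N -> a <= p i) -> a <= m%:R^-1.
  move=> pa; rewrite -div1r ler_pdivlMr// -{2}sump.
  have -> : a * m%:R = \sum_(0 <= i < m) a.
    by rewrite big_const_nat subn0 iter_addr_0 mulr_natr.
  by rewrite big_nat [leRHS]big_nat; apply: ler_sum => i /andP[_ im]; exact: pa.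
have pc0 : p c <= p 0%N by apply: p_dec; rewrite cm.
have pcm : p m.-1 <= p c by apply: p_dec; lia.
have h1 : m%:R^-1 <= p 0%N by apply: up => i im; apply: p_dec; rewrite im.
have h2 : p m.-1 <= m%:R^-1 by apply: lo => i im; apply: p_dec; lia.
rewrite -/(p c) ler_norml; apply/andP; split; lra.
Qed.

End countdown.

End hitting_times.

(** * The mean ergodic theorem *)

Section mean_ergodic.
Context d (X : measurableType d) (R : realType) (P : probability X R) (T : X -> X).
Hypothesis T_mp : measure_preserving P T.
Hypothesis T_erg : ergodic P T.
Implicit Types (A : set X) (f u q : X -> R).
Local Notation pr := (prob P).
Local Notation expect := (mean P).

Definition birkhoff q n x : R := \sum_(0 <= i < n) q (iter i T x).

Lemma birkhoffS q n x : birkhoff q n.+1 x = q x + birkhoff q n (T x).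
Proof.
rewrite /birkhoff big_nat_recl//=; congr (_ + _).
by apply: eq_bigr => i _; rewrite -iterSr.
Qed.

Lemma birkhoffD q m n x :
  birkhoff q (m + n) x = birkhoff q m x + birkhoff q n (iter m T x).
Proof.
elim: m x => [|m IH] x; first by rewrite /birkhoff [in X in _ = X + _]big_geq// add0r.
by rewrite addSn !birkhoffS IH addrA iterSr.
Qed.

Lemma bdd_meas_birkhoff q n : bdd_meas q -> bdd_meas (birkhoff q n).
Proof. by move=> bq; apply: bdd_meas_sum => i _; exact: (bdd_meas_iter T_mp). Qed.

Lemma expect_birkhoff q n : bdd_meas q -> expect (birkhoff q n) = n%:R * expect q.
Proof.
move=> bq; rewrite /birkhoff expect_sum; last by move=> i _; exact: (bdd_meas_iter T_mp).
under eq_bigr do rewrite expect_iter//.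
by rewrite big_const_nat subn0 iter_addr_0 mulr_natl.
Qed.

Lemma measurable_ge f (a : R) : measurable_fun setT f -> measurable [set x | a <= f x].
Proof.
move=> mf; rewrite (_ : [set x | _] = f @^-1` `[a, +oo[).
  by rewrite -[X in measurable X]setTI; exact: mf.
by apply/seteqP; split => x /=; rewrite in_itv/= andbT.
Qed.

Section bounded_by_one.
Variable q : X -> R.
Hypothesis mq : measurable_fun [set: X] q.
Hypothesis q01 : forall x, 0 <= q x <= 1.

Lemma bdd_meas01 : bdd_meas q.
Proof. by split => //; exists 1 => x; have /andP[q0 q1] := q01 x; rewrite ger0_norm. Qed.

Let bq := bdd_meas01.

Let Eq0 : 0 <= expect q.
Proof. by apply: expect_ge0 => x; have /andP[] := q01 x. Qed.

Let above (c : R) (B : nat) : set X :=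
  [set x | exists n, B%:R <= birkhoff q n x - c * n%:R].

Let measurable_above c B : measurable (above c B).
Proof.
rewrite (_ : above c B = \bigcup_n [set x | B%:R + c * n%:R <= birkhoff q n x]).
  apply: bigcup_measurable => n _; apply: measurable_ge.
  by have [] := bdd_meas_birkhoff n bq.
by apply/seteqP; split => x [n]; rewrite ?lerBrDr; exists n => //=; rewrite ?lerBrDr.
Qed.

(* The Katznelson-Weiss covering argument: if almost every orbit had blocks of
   average at least c, then long orbits would be covered by such blocks of bounded
   length, up to a small proportion of points where q is raised to at least c. *)
Lemma expect_lt_bounded (c : R) : expect q < c -> pr (\bigcap_B above c B) = 0.
Proof.
move=> qc; have c0 : 0 < c by exact: le_lt_trans Eq0 qc.
set G := \bigcap_B _.
have mG : measurable G by apply: bigcapT_measurable => B; exact: measurable_above.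
have invG : T @^-1` G = G.
  (* One step along the orbit changes the excess [birkhoff q n x - c * n] by less than [K], which
     does not affect membership in all the [above c B]. *)
  pose K := (Num.truncn (c + 1)).+1.
  have cK : c + 1 < K%:R by rewrite truncnS_gt.
  apply/seteqP; split => x Gx B _ /=.
    have [n] := Gx (B + K)%N I; exists n.+1.
    rewrite birkhoffS -[in c * _]natr1 mulrDr mulr1.
    by rewrite natrD in p; have /andP[q0 q1] := q01 x; lra.
  have [[|n]] := Gx (B + K)%N I.
    rewrite /birkhoff big_geq// mulr0 subr0 natrD => h.
    have := ler0n R B; lra.
  rewrite birkhoffS -[in c * _]natr1 mulrDr mulr1 natrD => h; exists n.
  by have /andP[q0 q1] := q01 x; lra.
have [] := T_erg mG invG; rewrite prE// => -[] // G1; exfalso.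
(* Points at which no block of length at most [L] has average at least [c]; they become rare as [L]
   grows. *)
pose D L := [set x | forall n, (0 < n <= L)%N -> birkhoff q n x < c * n%:R].
have mD L : measurable (D L).
  rewrite (_ : D L = \bigcap_(n in [set n | (0 < n <= L)%N])
      ~` [set x | c * n%:R <= birkhoff q n x]).
    apply: bigcap_measurableType => n _; apply: measurableC; apply: measurable_ge.
    by have [] := bdd_meas_birkhoff n bq.
  by apply/seteqP; split => x Dx n /= nL; [apply/negP; rewrite -ltNge|
    rewrite ltNge; apply/negP]; exact: Dx.
have dD L : D L.+1 `<=` D L.
  by move=> x Dx n /andP[n0 nL]; apply: Dx; rewrite n0 (leq_trans nL).
have D0 : pr (\bigcap_L D L) = 0.
  apply/eqP; rewrite eq_le pr_ge0 andbT.
  have <- : pr (~` G) = 0 by rewrite prC// G1 subrr.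
  apply: le_pr; [exact: bigcapT_measurable|exact: measurableC|].
  move=> x Dx /(_ 1%N I)[[|n]].
    by rewrite /birkhoff big_geq// mulr0 subr0 leNgt ltr01.
  by have := Dx n.+1 I n.+1; rewrite ltn0Sn leqnn => /(_ isT); lra.
(* The threshold for [pr (D L)] that keeps the mean of the raised function [q'] below [c]. *)
have e0 : 0 < (c - expect q) / c by rewrite divr_gt0// subr_gt0.
have [L] := pr_bigcap_approx P e0 mD dD.
rewrite D0 add0r ltr_pdivlMr// => DL.
pose q' x := q x + c * \1_(D L) x.
have bI : bdd_meas (fun x => c * \1_(D L) x : R) by exact/bdd_measZ/bdd_meas_indic.
have bq' : bdd_meas q' by exact: bdd_measD.
have Eq' : expect q' = expect q + c * pr (D L).
  by rewrite expectD// expectZ ?expect_indic//; exact: bdd_meas_indic.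
have qq' x : q x <= q' x by rewrite lerDl mulr_ge0// ?ltW// indicE.
have bqq' n x : birkhoff q n x <= birkhoff q' n x by apply: ler_sum => i _.
have bq'0 n x : 0 <= birkhoff q' n x.
  apply: le_trans (bqq' n x); apply: sumr_ge0 => i _.
  by have /andP[] := q01 (iter i T x).
have cov n x : c * (n%:R - L%:R) <= birkhoff q' n x.
  elim/ltn_ind: n x => n IH x.
  have [nL|Ln] := leqP n L.
    apply: le_trans (bq'0 n x).
    by rewrite pmulr_rle0// subr_le0 ler_nat.
  have [Dx|nDx] := pselect (D L x).
    case: n IH Ln => // n IH Ln; rewrite birkhoffS.
    have := IH n (ltnSn n) (T x).
    have : c <= q' x.
      rewrite /q' indicE mem_set//= mulr1 lerDr.
      by have /andP[] := q01 x.
    by rewrite -[n.+1%:R]natr1; lra.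
  have [m /andP[m0 mL] cm] : exists2 m, (0 < m <= L)%N & c * m%:R <= birkhoff q m x.
    apply: contrapT => nex; apply: nDx => m mL; rewrite ltNge; apply/negP => cm.
    by apply: nex; exists m.
  have mn : (m <= n)%N by lia.
  have := IH (n - m)%N; rewrite ltn_subrL m0 (leq_ltn_trans _ Ln)//= => /(_ isT (iter m T x)).
  have -> : birkhoff q' n x = birkhoff q' m x + birkhoff q' (n - m) (iter m T x).
    by rewrite -birkhoffD subnKC.
  rewrite natrB// => h.
  by have := bqq' m x; lra.
(* Integrating the covering bound gives an inequality that fails for large [n]. *)
have lin n : (c - expect q') * n%:R <= c * L%:R.
  have : c * (n%:R - L%:R) <= n%:R * expect q'.
    rewrite -expect_birkhoff// -[leLHS](expect_cst P).
    by apply: le_expect => //; [exact: bdd_meas_cst|exact: bdd_meas_birkhoff].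
  by lra.
have c'0 : 0 < c - expect q' by rewrite Eq'; lra.
have := lin (Num.truncn (c * L%:R / (c - expect q'))).+1.
apply/negP; rewrite -ltNge [ltRHS]mulrC -ltr_pdivrMr//.
by rewrite truncnS_gt.
Qed.

(** Only upward deviations need control: [h] has mean 0, so the mean of its absolute value is that
    of [|h| + h], twice the positive part. Off a small event the excess over [c] stays below a fixed
    [B], which is negligible after division by a large [M]. *)
Lemma mean_ergodic (e : R) : 0 < e ->
  exists2 M, (0 < M)%N & expect (fun x => `|birkhoff q M x / M%:R - expect q|) <= e.
Proof.
move=> e0; pose c := expect q + e / 8.
have qc : expect q < c by rewrite /c; lra.
have e8 : 0 < e / 8 by lra.
have dA B : above c B.+1 `<=` above c B.
  by move=> x [n h]; exists n; apply: le_trans h; rewrite ler_nat.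
have [B] := pr_bigcap_approx P e8 (measurable_above c) dA.
rewrite expect_lt_bounded// add0r => BE.
pose M := (Num.truncn (B%:R / (e / 8))).+1.
have M0 : (0 : R) < M%:R by rewrite ltr0n.
have BM : B%:R < e / 8 * M%:R by rewrite mulrC -ltr_pdivrMr// truncnS_gt.
exists M => //.
pose h x := birkhoff q M x / M%:R - expect q.
have bh : bdd_meas h.
  apply: bdd_measB; last exact: bdd_meas_cst.
  by apply: bdd_measM; [exact: bdd_meas_birkhoff|exact: bdd_meas_cst].
have Eh : expect h = 0.
  rewrite expectB; [|apply: bdd_measM; [exact: bdd_meas_birkhoff|exact: bdd_meas_cst]
    |exact: bdd_meas_cst].
  under eq_fun do rewrite mulrC.
  rewrite expectZ; last exact: bdd_meas_birkhoff.
  by rewrite expect_birkhoff// expect_cst mulKf ?subrr// gt_eqF.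
have q1 : expect q <= 1.
  rewrite -[leRHS](expect_cst P 1); apply: le_expect => // [|x]; first exact: bdd_meas_cst.
  by have /andP[] := q01 x.
have S01 x : 0 <= birkhoff q M x / M%:R <= 1.
  apply/andP; split.
    by rewrite divr_ge0// sumr_ge0// => i _; have /andP[] := q01 (iter i T x).
  rewrite ler_pdivrMr// mul1r.
  apply: le_trans (_ : \sum_(0 <= i < M) 1 <= _).
    by apply: ler_sum => i _; have /andP[] := q01 (iter i T x).
  by rewrite big_const_nat subn0 iter_addr_0.
have -> : expect (fun x => `|h x|) = expect (fun x => `|h x| + h x).
  by rewrite expectD ?Eh ?addr0//; exact: bdd_meas_norm.
have mC : measurable (~` above c B) by exact/measurableC/measurable_above.
apply: le_trans (expect_le_good P (A := ~` above c B) (e := e / 2) (C := 2) _ _ _ _ _ _) _.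
- lra.
- lra.
- by apply: bdd_measD => //; exact: bdd_meas_norm.
- exact: mC.
- move=> x nA.
  have : h x < e / 4.
    have : birkhoff q M x - c * M%:R < B%:R.
      by rewrite ltNge; apply/negP => Bx; apply: nA; exists M.
    rewrite /h => H; rewrite ltrBlDr ltr_pdivrMr//; move: H; rewrite /c; lra.
  have [h0|h0] := lerP 0 (h x); [rewrite ger0_norm//; lra|rewrite ltr0_norm//; lra].
- move=> x; have /andP[s0 s1] := S01 x.
  have h1 : h x <= 1 by rewrite /h lerBlDr (le_trans s1)// lerDl.
  have [h0|h0] := lerP 0 (h x); [rewrite ger0_norm//; lra|rewrite ltr0_norm//; lra].
- rewrite setCK; lra.
Qed.

Lemma expect_iter_dist u n : bdd_meas u ->
  expect (fun x => `|u (iter n T x) - u x|) <= n%:R * expect (fun x => `|u (T x) - u x|).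
Proof.
move=> bu; have [mT _] := T_mp.
have bT : bdd_meas (fun x => `|u (T x) - u x|).
  by apply/bdd_meas_norm/bdd_measB => //; exact: bdd_meas_comp.
elim: n => [|n IH].
  under eq_fun do rewrite subrr normr0.
  by rewrite expect_cst mul0r.
have bn : bdd_meas (fun x => `|u (iter n T x) - u x|).
  by apply/bdd_meas_norm/bdd_measB => //; exact: (bdd_meas_iter T_mp).
rewrite -natr1 mulrDl mul1r.
apply: le_trans (lerD IH (lexx _)).
rewrite -[X in _ + X](expect_iter T_mp n)// -expectD//; last exact: (bdd_meas_iter T_mp n bT).
apply: le_expect => [||x].
- by apply/bdd_meas_norm/bdd_measB => //; exact: (bdd_meas_iter T_mp n.+1 bu).
- by apply: bdd_measD => //; exact: (bdd_meas_iter T_mp n bT).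
- rewrite -iterS [leRHS]addrC; apply: le_trans (ler_normD _ _).
  by rewrite addrA subrK.
Qed.

(* Averaging over time replaces q by its ergodic average, while u hardly moves. *)
Lemma almost_invariant_decouple (e : R) : 0 < e ->
  exists2 rho : R, 0 < rho & forall u, bdd_meas u -> (forall x, `|u x| <= 1) ->
    expect (fun x => `|u (T x) - u x|) <= rho ->
    `|expect (fun x => u x * q x) - expect u * expect q| <= e.
Proof.
move=> e0.
have e2 : 0 < e / 2 by rewrite divr_gt0.
have [M M0 ME] := mean_ergodic e2.
have MR : (0 : R) < M%:R by rewrite ltr0n.
(* With this [rho], the mean displacement of [u] over at most [M] steps is at most [e / 2]. *)
exists (e / 2 / M%:R); first by rewrite divr_gt0.
move=> u bu u1 urho.
have buq i : bdd_meas (fun x => u x * q (iter i T x)).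
  by apply: bdd_measM => //; exact: (bdd_meas_iter T_mp).
have shift i : (0 <= i < M)%N ->
    `|expect (fun x => u x * q x) - expect (fun x => u x * q (iter i T x))| <= e / 2.
  move=> /andP[_ iM].
  have bui : bdd_meas (fun x => u (iter i T x)) by exact: (bdd_meas_iter T_mp).
  have bqi : bdd_meas (fun x => q (iter i T x)) by exact: (bdd_meas_iter T_mp).
  rewrite -(expect_iter T_mp i (f := fun x => u x * q x)); last exact: bdd_measM.
  rewrite -expectB//; last exact: bdd_measM.
  rewrite (_ : (fun x => _) = (fun x => q (iter i T x) * (u (iter i T x) - u x))); last first.
    by apply/funext => x; ring.
  apply: le_trans (norm_expectM_le P (C := 1) (f := fun x => q (iter i T x))
    (g := fun x => u (iter i T x) - u x) _ _ _) _ => //.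
  - exact: bdd_measB.
  - by move=> x; have /andP[q0 q1] := q01 (iter i T x); rewrite ger0_norm.
  - rewrite mul1r; apply: le_trans (expect_iter_dist i bu) _.
    apply: le_trans (ler_wpM2l _ urho) _ => //.
    by rewrite mulrA ler_pdivrMr// [leLHS]mulrC ler_pM2l// ler_nat ltnW.
have bS : bdd_meas (fun x => u x * birkhoff q M x).
  by apply: bdd_measM => //; exact: bdd_meas_birkhoff.
have avg : `|expect (fun x => u x * q x) - expect (fun x => u x * birkhoff q M x) / M%:R| <= e / 2.
  have -> : expect (fun x => u x * birkhoff q M x) =
      \sum_(0 <= i < M) expect (fun x => u x * q (iter i T x)).
    rewrite -expect_sum; last by move=> i _; exact: buq.
    by congr (mean P _); apply/funext => x; rewrite /birkhoff mulr_sumr.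
  rewrite -(ler_pM2r MR) -{2}(gtr0_norm MR) -normrM mulrBl divfK ?gt_eqF//.
  have cs (a : R) : a * M%:R = \sum_(0 <= i < M) a.
    by rewrite big_const_nat subn0 iter_addr_0 mulr_natr.
  rewrite !cs -sumrB; apply: le_trans (ler_norm_sum _ _ _) _.
  by rewrite big_nat [leRHS]big_nat; apply: ler_sum => i iM; exact: shift.
have erg : `|expect (fun x => u x * birkhoff q M x) / M%:R - expect u * expect q| <= e / 2.
  have bh : bdd_meas (fun x => birkhoff q M x / M%:R - expect q).
    apply: bdd_measB; last exact: bdd_meas_cst.
    by apply: bdd_measM; [exact: bdd_meas_birkhoff|exact: bdd_meas_cst].
  have <- : expect (fun x => u x * (birkhoff q M x / M%:R - expect q)) =
      expect (fun x => u x * birkhoff q M x) / M%:R - expect u * expect q.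
    transitivity (expect (fun x =>
        M%:R^-1 * (u x * birkhoff q M x) - expect q * u x)).
      by congr (mean P _); apply/funext => x; ring.
    by rewrite expectB ?expectZ//; [ring|exact: bdd_measZ|exact: bdd_measZ].
  apply: le_trans (norm_expectM_le P bu bh u1) _ => //.
  by rewrite mul1r.
rewrite (_ : e = e / 2 + e / 2); last by field.
by apply: le_trans (ler_distD _ _ _) (lerD avg erg).
Qed.

End bounded_by_one.
End mean_ergodic.

(** * Almost invariant, almost independent variables *)

(** A law is approximated by the letter frequencies of a word, which can then be read along a
    countdown. The letter [v] is repeated [truncn (N * p v) + 1] times; rounding adds at most 1 per
    letter, hence at most [r] in total, and [N] exceeds [r / e]. *)
Lemma frequency_word (R : realType) (r : nat) (p : nat -> R) (e : R) : 0 < e ->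
  (forall v, (v < r)%N -> 0 <= p v) -> \sum_(0 <= v < r) p v = 1 ->
  exists s : seq nat, [/\ (0 < size s)%N, (forall v, v \in s -> (v < r)%N) &
    forall v, (v < r)%N -> `|(count_mem v s)%:R / (size s)%:R - p v| <= e].
Proof.
move=> e0 p0 p1.
have r0 : (0 < r)%N.
  by case: r p0 p1 => // _; rewrite big_geq// => /eqP; rewrite eq_sym oner_eq0.
pose N := (Num.truncn (r%:R / e)).+1.
have N0 : (0 : R) < N%:R by rewrite ltr0n.
have rN : r%:R <= e * N%:R by rewrite mulrC -ler_pdivrMr// ltW// truncnS_gt.
pose n v := (Num.truncn (N%:R * p v)).+1.
have nlo v : N%:R * p v <= (n v)%:R by rewrite ltW// truncnS_gt.
have nup v : (v < r)%N -> (n v)%:R <= N%:R * p v + 1.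
  by move=> vr; rewrite -natr1 lerD2r truncn_le mulr_ge0// ?p0// ltW.
pose s := flatten [seq nseq (n v) v | v <- iota 0 r].
have size_s : size s = (\sum_(0 <= v < r) n v)%N.
  rewrite size_flatten /shape -map_comp sumnE big_map /index_iota subn0.
  by apply: eq_bigr => v _ /=; rewrite size_nseq.
have mem_s v : v \in s -> (v < r)%N.
  by move=> /flatten_mapP[w]; rewrite mem_iota add0n => /andP[_ wr] /nseqP[->].
have count_s v : (v < r)%N -> count_mem v s = n v.
  move=> vr; rewrite count_flatten -map_comp sumnE big_map.
  rewrite (bigD1_seq v) ?iota_uniq ?mem_iota//= count_nseq/= eqxx mul1n big1 ?addn0// => w wv.
  by rewrite /= count_nseq/= (negbTE wv) mul0n.
have GN : N%:R <= (size s)%:R :> R.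
  have -> : N%:R = \sum_(0 <= v < r) N%:R * p v :> R by rewrite -mulr_sumr p1 mulr1.
  rewrite size_s natr_sum.
  by apply: ler_sum => v _; exact: nlo.
have Gup : (size s)%:R <= N%:R + r%:R :> R.
  rewrite size_s natr_sum.
  have -> : N%:R + r%:R = \sum_(0 <= v < r) (N%:R * p v + 1) :> R.
    by rewrite big_split/= -mulr_sumr p1 mulr1 big_const_nat subn0 iter_addr_0.
  by rewrite big_nat [leRHS]big_nat; apply: ler_sum => v /andP[_]; exact: nup.
have G0 : (0 : R) < (size s)%:R by exact: lt_le_trans GN.
have p_le1 v : (v < r)%N -> p v <= 1.
  move=> vr; rewrite -p1 (bigD1_seq v)/= ?mem_index_iota ?iota_uniq//.
  rewrite lerDl big_seq_cond; apply: sumr_ge0 => w.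
  by rewrite mem_index_iota => /andP[/andP[_ /p0]].
exists s; split => //; first by rewrite -(ltr_nat R).
move=> v vr; rewrite count_s//.
have r1 : (1 : R) <= r%:R by rewrite ler1n.
have := nlo v; have := nup v vr; have := p0 v vr; have := p_le1 v vr => v1 v0 v2 v3.
have a1 : p v * (size s)%:R <= N%:R * p v + r%:R.
  have : p v * (size s)%:R <= p v * (N%:R + r%:R) by rewrite ler_wpM2l.
  have : p v * r%:R <= r%:R by rewrite ler_piMl.
  by lra.
have a2 : N%:R * p v <= p v * (size s)%:R by rewrite mulrC ler_wpM2l.
have a3 : e * N%:R <= e * (size s)%:R by rewrite ler_pM2l.
rewrite ler_distl; apply/andP; split.
  by rewrite ler_pdivlMr//; lra.
by rewrite ler_pdivrMr//; lra.
Qed.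

Section local_variables.
Context d (X : measurableType d) (R : realType) (P : probability X R) (T : X -> X).
Hypothesis P_na : nonatomic P.
Hypothesis T_mp : measure_preserving P T.
Hypothesis T_erg : ergodic P T.
Implicit Types (A : set X).
Local Notation pr := (prob P).
Local Notation expect := (mean P).

Definition moves (L : nat) (V : X -> nat) : set X :=
  [set x | exists2 n, (n <= L)%N & V (iter n T x) <> V x].

Lemma measurable_moves L V : measurable_fun [set: X] V -> measurable (moves L V).
Proof.
move=> mV.
rewrite (_ : moves L V = \bigcup_(n in [set n | (n <= L)%N]) [set x | V (iter n T x) <> V x]).
  apply: bigcup_measurable => n _.
  apply: (measurable_nat2 (fun a b => a <> b)) => //.
  exact: measurableT_comp mV (measurable_iter T_mp n).
by apply/seteqP; split => x [n nL h]; exists n.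
Qed.

(** [V] reads a word of length [G] cyclically, spending [l] steps of a countdown on each letter. The
    near uniformity of the countdown modulo [G * l] yields the law. The letter changes within [L]
    steps only if the countdown, or its residue modulo [l], is below [L]. *)
Lemma local_variable (L r : nat) (p : nat -> R) (e : R) : 0 < e ->
  (forall v, (v < r)%N -> 0 <= p v) -> \sum_(0 <= v < r) p v = 1 ->
  exists V : X -> nat, [/\ measurable_fun [set: X] V, (forall x, (V x < r)%N),
    (forall v, (v < r)%N -> `|pr [set x | V x = v] - p v| <= e) &
    pr (moves L V) <= e].
Proof.
move=> e0 p0 p1.
have e2 : 0 < e / 2 by rewrite divr_gt0.
have [s [s0 sr sp]] := frequency_word e2 p0 p1.
pose G := size s.
pose l := (Num.truncn (L%:R / (e / 2))).+1.
have l0 : (0 : R) < l%:R by rewrite ltr0n.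
have Ll : L%:R <= e / 2 * l%:R by rewrite mulrC -ler_pdivrMr// ltW// truncnS_gt.
pose m := (G * l)%N.
have m0 : (0 < m)%N by rewrite muln_gt0 s0.
(* Each of the [m] residues, and each of the [L] time steps, adds an error [eta]; either total is at
   most [e / 4]. *)
pose eta := e / 4 / (L + m).+1%:R.
have D0 : (0 : R) < (L + m).+1%:R by rewrite ltr0n.
have eta0 : 0 < eta by rewrite /eta !divr_gt0.
have etaD : eta * (L + m).+1%:R = e / 4 by rewrite /eta divfK// gt_eqF.
have etaL : eta * L%:R <= e / 4.
  by rewrite -etaD ler_pM2l// ler_nat; lia.
have etam : eta * m%:R <= e / 4.
  by rewrite -etaD ler_pM2l// ler_nat; lia.
have [rr [mr rT r0]] := hitting_time T_mp T_erg P_na eta0.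
pose V x := nth 0%N s ((rr x %% m) %/ l).
have ltG t : (t < m)%N -> (t %/ l < G)%N by move=> tm; rewrite ltn_divLR.
have mV : measurable_fun [set: X] V.
  by apply: measurable_fun_natP => i; exact: (measurable_nat1 (fun j => nth 0%N s ((j %% m) %/ l) = i)).
exists V; split => //.
- by move=> x; apply: sr; rewrite mem_nth// ltG// ltn_pmod.
- move=> v vr.
  have mQ (Q : nat -> Prop) : measurable [set x | Q (rr x)] by exact: measurable_nat1.
  have -> : pr [set x | V x = v] = \sum_(0 <= t < m)
      (nth 0%N s (t %/ l) == v)%:R * pr [set x | (rr x %% m)%N = t].
    have -> : [set x | V x = v] = [set x | V x = v] `&` [set x | (rr x %% m < m)%N].
      by apply/seteqP; split => x //= => [Vx|[]//]; split => //; rewrite ltn_pmod.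
    rewrite (pr_bigcupI P m (V := fun x => (rr x %% m)%N)); last first.
    - by apply: measurable_fun_natP => i; exact: (mQ (fun j => (j %% m)%N = i)).
    - exact: (mQ (fun j => nth 0%N s ((j %% m) %/ l) = v)).
    apply: eq_bigr => t _; case: eqP => tv; rewrite ?mul1r ?mul0r.
      by congr pr; apply/seteqP; split => x /=; [by case|by rewrite /V => tx; rewrite tx].
    rewrite -[RHS](pr_set0 P); congr pr; apply/seteqP; split => x //=.
    by rewrite /V => -[+ tx]; rewrite tx.
  have cnt : \sum_(0 <= t < m) ((nth 0%N s (t %/ l) == v)%:R : R) = (count_mem v s)%:R * l%:R.
    rewrite /m big_nat_mul.
    rewrite [X in _ = X%:R * _](_ : _ = \sum_(0 <= c < G) (nth 0%N s c == v))%N; last first.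
      rewrite -sum1_count [LHS](big_nth 0%N) [LHS]big_mkcond /= -/G.
      apply: eq_bigr => c _ /=.
      by case: (_ == _).
    rewrite natr_sum mulr_suml; apply: eq_bigr => c _.
    rewrite (eq_big_nat _ _ (F2 := fun=> (nth 0%N s c == v)%:R)); last first.
      move=> t /andP[ct tc]; congr ((nth _ _ _ == _)%:R).
      by apply/eqP; rewrite eqn_leq leq_divRL// ct andbT -ltnS ltn_divLR.
    by rewrite big_const_nat iter_addr_0 mulSn addnK mulr_natr.
  have E1 : `|\sum_(0 <= t < m) (nth 0%N s (t %/ l) == v)%:R * pr [set x | (rr x %% m)%N = t]
     - (count_mem v s)%:R / G%:R| <= e / 4.
    have -> : (count_mem v s)%:R / G%:R =
        \sum_(0 <= t < m) ((nth 0%N s (t %/ l) == v)%:R : R) * m%:R^-1.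
      rewrite -mulr_suml cnt /m natrM; field.
      by rewrite !gt_eqF//= ltr0n.
    rewrite -sumrB; apply: le_trans etam.
    have -> : eta * m%:R = \sum_(0 <= t < m) eta.
      by rewrite big_const_nat subn0 iter_addr_0 mulr_natr.
    apply: le_trans (ler_norm_sum _ _ _) _.
    rewrite big_nat [leRHS]big_nat; apply: ler_sum => t /andP[_ tm].
    rewrite -mulrBr normrM.
    apply: le_trans (pr_countdown_mod T_mp mr rT r0 tm).
    by rewrite ler_piMl//; case: (_ == _); rewrite ?normr1 ?normr0.
  apply: le_trans (ler_distD ((count_mem v s)%:R / G%:R) _ _) _.
  by have := sp v vr; rewrite -/G; lra.
- have mQ (Q : nat -> Prop) : measurable [set x | Q (rr x)] by exact: measurable_nat1.
  have sub : moves L V `<=` [set x | (rr x < L)%N] `|`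
      \bigcup_(i < L) [set x | (rr x %% l)%N = i].
    move=> x [n nL Vn]; apply: contrapT => nUx; apply: Vn.
    have Lr : (L <= rr x)%N by rewrite leqNgt; apply/negP => h; apply: nUx; left.
    have Lm : (L <= rr x %% l)%N.
      by rewrite leqNgt; apply/negP => h; apply: nUx; right; exists (rr x %% l)%N.
    rewrite /V (countdown_iter rT (leq_trans nL Lr)).
    have modl t : ((t %% m) %/ l = (t %/ l) %% G)%N by rewrite modn_divl.
    rewrite !modl; congr (nth _ _ (_ %% _)).
    rewrite {1}(divn_eq (rr x) l) -addnBA ?(leq_trans nL)// divnMDl//.
    have h : (rr x %% l - n < l)%N by rewrite (leq_ltn_trans (leq_subr _ _))// ltn_pmod.
    by rewrite (divn_small h) addn0.
  apply: le_trans (le_pr P _ _ sub) _.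
  + exact: measurable_moves.
  + apply: measurableU; first exact: (mQ (fun i => (i < L)%N)).
    by apply: bigcup_measurable => i _; exact: (mQ (fun j => (j %% l)%N = i)).
  apply: le_trans (prU_le P _ _) _.
  + exact: (mQ (fun i => (i < L)%N)).
  + by apply: bigcup_measurable => i _; exact: (mQ (fun j => (j %% l)%N = i)).
  (* If [l < L], then [e] is at least 2 and the bound is trivial; otherwise every number below [L]
     is a residue modulo [l]. *)
  have [lL|Ll2] := ltnP l L.
    have e1 : 1 <= e / 2.
      rewrite -(ler_pM2r l0) mul1r; apply: le_trans Ll.
      by rewrite ler_nat ltnW.
    have := pr_le1 P (mQ (fun i => (i < L)%N)).
    have : pr (\bigcup_(i < L) [set x | (rr x %% l)%N = i]) <= 1.
      by apply: pr_le1; apply: bigcup_measurable => i _; exact: (mQ (fun j => (j %% l)%N = i)).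
    by lra.
  have Ll' : L%:R / l%:R <= e / 2 by rewrite ler_pdivrMr.
  have h1 := pr_countdown_lt T_mp mr rT r0 L.
  have h2 : pr (\bigcup_(i < L) [set x | (rr x %% l)%N = i]) <= L%:R * (l%:R^-1 + eta).
    have -> : L%:R * (l%:R^-1 + eta) = \sum_(0 <= i < L) (l%:R^-1 + eta).
      by rewrite big_const_nat subn0 iter_addr_0 mulr_natl.
    apply: pr_bigU_le => i iL; first exact: (mQ (fun j => (j %% l)%N = i)).
    have := pr_countdown_mod T_mp mr rT r0 (leq_trans iL Ll2).
    by rewrite ler_distl => /andP[_]; rewrite addrC.
  by lra.
Qed.

(** The indicator of a value of [V] changes in one step only where [V] moves, so it can be made as
    nearly invariant as the decoupling requires; finitely many sets [A k] share one threshold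
    [rho]. *)
Lemma indep_variable (n : nat) (A : nat -> set X) (L r : nat) (p : nat -> R) (e : R) :
  (forall k, measurable (A k)) -> 0 < e ->
  (forall v, (v < r)%N -> 0 <= p v) -> \sum_(0 <= v < r) p v = 1 ->
  exists V : X -> nat, [/\ measurable_fun [set: X] V, (forall x, (V x < r)%N),
    (forall k v, (k < n)%N -> (v < r)%N ->
      `|pr (A k `&` [set x | V x = v]) - pr (A k) * p v| <= e) &
    pr (moves L V) <= e].
Proof.
move=> mA e0 p0 p1.
have e2 : 0 < e / 2 by rewrite divr_gt0.
have [rho rho0 H] : exists2 rho : R, 0 < rho & forall k, (k < n)%N ->
    forall u, bdd_meas u -> (forall x, `|u x| <= 1) ->
    expect (fun x => `|u (T x) - u x|) <= rho ->
    `|expect (fun x => u x * \1_(A k) x) - expect u * expect (\1_(A k))| <= e / 2.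
  elim: n => [|n [rho rho0 IH]]; first by exists 1.
  have I01 x : 0 <= (\1_(A n) x : R) <= 1.
    by rewrite indicE; case: (_ \in _) => /=; rewrite ler01 lexx.
  have [rho' rho'0 H'] := almost_invariant_decouple T_mp T_erg (q := \1_(A n))
    (proj1 (bdd_meas_indic R (mA n))) I01 e2.
  exists (Num.min rho rho'); first by rewrite lt_min rho0.
  move=> k; rewrite ltnS leq_eqVlt => /orP[/eqP->|kn] u bu u1; rewrite le_min => /andP[h h'].
    exact: H'.
  exact: IH.
have e'0 : 0 < Num.min rho (e / 2) by rewrite lt_min rho0.
(* [L.+1] instead of [L], so that a single step of [T] is covered even when [L] is 0. *)
have [V [mV Vr Vp]] := local_variable L.+1 e'0 p0 p1.
rewrite le_min => /andP[Vrho Ve2].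
have mVv v : measurable [set x | V x = v] by exact: (measurable_nat1 (fun i => i = v)).
exists V; split => //.
- move=> k v kn vr.
  pose u : X -> R := \1_[set x | V x = v].
  have bu : bdd_meas u by exact: bdd_meas_indic.
  have Eu : expect u = pr [set x | V x = v] by rewrite expect_indic.
  have uA : expect (fun x => u x * \1_(A k) x) = pr (A k `&` [set x | V x = v]).
    rewrite -expect_indic; last exact: measurableI.
    by congr (mean P _); apply/funext => x; rewrite /u setIC indicI.
  have u1 x : `|u x| <= 1.
    by rewrite /u indicE; case: (_ \in _); rewrite ?normr1 ?normr0.
  have [mT _] := T_mp.
  have urho : expect (fun x => `|u (T x) - u x|) <= rho.
    apply: le_trans Vrho; rewrite -expect_indic; last exact: measurable_moves.
    apply: le_expect => [||x].
    - by apply/bdd_meas_norm/bdd_measB => //; exact: bdd_meas_comp.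
    - exact/bdd_meas_indic/measurable_moves.
    have [VT|VT] := pselect (V (T x) = V x).
      rewrite /u !indicE (_ : (T x \in _) = (x \in [set x | V x = v])).
        by rewrite subrr normr0.
      by apply/idP/idP => /set_mem /= h; apply/mem_set => /=; rewrite -h.
    rewrite (_ : \1_(moves _ _) x = 1); last first.
      by rewrite indicE mem_set//; exists 1%N.
    by rewrite /u !indicE; do 2 case: (_ \in _); rewrite /= ?subrr ?subr0 ?sub0r ?normrN ?normr1 ?normr0.
  have := H k kn u bu u1 urho; rewrite uA Eu expect_indic// => h1.
  have h2 := Vp v vr.
  rewrite le_min in h2; have /andP[_ h3] := h2.
  have A0 := pr_ge0 P (A k); have A1 := pr_le1 P (mA k).
  have h4 : `|pr [set x | V x = v] * pr (A k) - pr (A k) * p v| <= e / 2.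
    rewrite [X in X - _]mulrC -mulrBr normrM ger0_norm//.
    by apply: le_trans h3; rewrite ler_piMl.
  rewrite (_ : e = e / 2 + e / 2); last by field.
  exact: le_trans (ler_distD _ _ _) (lerD h1 h4).
- have e2e : e / 2 <= e by lra.
  apply: le_trans e2e; apply: le_trans Ve2.
  apply: le_pr; [exact: measurable_moves..|].
  by move=> x [i iL h]; exists i => //; exact: leqW.
Qed.

(** With 0 standing for the absence of renewal, this is the event that no renewal occurs from step
    [k] on and before step [i]. Almost independence of [V i] from the past is only asked against
    these events. *)
Definition zeros (V : nat -> X -> nat) (k i : nat) : set X :=
  [set x | forall l, (k <= l < i)%N -> V l x = 0%N].

Lemma measurable_zeros V k i : (forall l, measurable_fun [set: X] (V l)) ->
  measurable (zeros V k i).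
Proof.
move=> mV; rewrite (_ : zeros V k i =
    \bigcap_(l in [set l | (k <= l < i)%N]) [set x | V l x = 0%N]).
  apply: bigcap_measurableType => l _.
  exact: (measurable_nat1 (fun i => i = 0%N)).
by apply/seteqP; split => x h l kl; exact: h.
Qed.

(** Dependent choice in which the state carried along is not the list of earlier variables but the
    events [zeros V k i], [k <= i]: this is all that the choice of [V i] has to know. *)
Lemma indep_sequence (L r : nat -> nat) (p : nat -> nat -> R) (e : nat -> R) :
  (forall i, 0 < e i) ->
  (forall i v, (v < r i)%N -> 0 <= p i v) ->
  (forall i, \sum_(0 <= v < r i) p i v = 1) ->
  exists V : nat -> X -> nat, forall i,
    [/\ measurable_fun [set: X] (V i), (forall x, (V i x < r i)%N),
      (forall k v, (k <= i)%N -> (v < r i)%N ->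
        `|pr (zeros V k i `&` [set x | V i x = v]) - pr (zeros V k i) * p i v| <= e i) &
      pr (moves (L i) (V i)) <= e i].
Proof.
move=> e0 p0 p1.
have nextP (iA : nat * (nat -> set X)) : exists V : X -> nat,
    let: (i, A) := iA in (forall k, measurable (A k)) ->
    [/\ measurable_fun [set: X] V, (forall x, (V x < r i)%N),
      (forall k v, (k < i.+1)%N -> (v < r i)%N ->
        `|pr (A k `&` [set x | V x = v]) - pr (A k) * p i v| <= e i) &
      pr (moves (L i) V) <= e i].
  case: iA => i A; have [mA|nA] := pselect (forall k, measurable (A k)).
    have [V ?] := indep_variable i.+1 (L i) mA (e0 i) (p0 i) (p1 i).
    by exists V.
  (* A dummy: the choice function is total, hence also defined on families with non-measurable
     members. *)
  by exists (fun=> 0%N).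
have [next Hnext] := choice nextP.
pose fix hist i : nat -> set X := if i is i'.+1 then
  fun k => if (k <= i')%N then hist i' k `&` [set x | next (i', hist i') x = 0%N] else setT
  else fun=> setT.
pose V i := next (i, hist i).
have mh i : forall k, measurable (hist i k).
  elim: i => [|i IH] k //=; case: ifP => // _; apply: measurableI => //.
  have [mV _ _ _] := Hnext (i, hist i) IH.
  exact: (measurable_nat1 (fun j => j = 0%N)).
have histE i k : (k <= i)%N -> hist i k = zeros V k i.
  elim: i k => [|i IH] k ki.
    by apply/seteqP; split => x // _ l; rewrite ltn0 andbF.
  rewrite /=; case: ifP => [ki'|ki'].
    rewrite IH//; apply/seteqP; split => x /=.
      move=> [h1 h2] l /andP[kl]; rewrite ltnS leq_eqVlt => /orP[/eqP->//|li].
      by apply: h1; rewrite kl.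
    by move=> h; split => [l /andP[kl li]|]; apply: h; rewrite ?kl ?ltnS ?(ltnW li) ?ki'/=.
  apply/seteqP; split => x // _ l /andP[kl li].
  by move: ki' kl li; lia.
exists V => i; have [mV Vr Vp Vm] := Hnext (i, hist i) (mh i); split => // k v ki vr.
by rewrite -histE//; exact: Vp.
Qed.

End local_variables.

(** * The renewal structure *)

Section renewal.
Context d (X : measurableType d) (R : realType) (P : probability X R) (T : X -> X).
Hypothesis T_mp : measure_preserving P T.
Context d' (X' : measurableType d') (P' : probability X' R) (Y : X' -> R).
Hypotheses (mY : measurable_fun [set: X'] Y) (Y_ge0 : forall w, 0 <= Y w).
Local Notation pr := (prob P).
Local Notation expect := (mean P).

(* Y is discretised as [code i Y / i.+1], with truncation to 0 of the values
   above i.+1. *)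
Definition code (i : nat) (w : X') : nat :=
  let v := Num.truncn (i.+1%:R * Y w) in if (v < i.+1 ^ 2)%N then v else 0%N.

(** One value per code, and one more for the absence of renewal. *)
Definition ncodes (i : nat) : nat := (i.+1 ^ 2).+1.

(* V_i = 0 means that no renewal occurs at step i; V_i = v.+1 is a renewal with
   new value v / i.+1. *)
Definition law (i v : nat) : R :=
  if v is v'.+1 then i.+1%:R^-1 * prob P' [set w | code i w = v'] else 1 - i.+1%:R^-1.

(** The error allowed on each single value of [V i]: over all [ncodes i] values it adds up to
    [2^-(i+1)], which is summable in [i]. *)
Definition tol (i : nat) : R := 2^-1 ^+ i.+1 / (ncodes i)%:R.

(** The predecessor undoes the shift that reserves 0 for the absence of renewal; that case gets the
    value 0. *)
Definition value (i v : nat) : R := v.-1%:R / i.+1%:R.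

Lemma code_lt i w : (code i w < i.+1 ^ 2)%N.
Proof. by rewrite /code; case: ifP => //; rewrite expn_gt0. Qed.

Lemma measurable_code i : measurable_fun [set: X'] (code i).
Proof.
have mt : measurable_fun [set: X'] (fun w => Num.truncn (i.+1%:R * Y w)).
  apply: measurable_fun_natP => v.
  have mZ : measurable_fun [set: X'] (fun w => i.+1%:R * Y w).
    exact: measurable_funM.
  rewrite (_ : _ @^-1` _ = [set w | v%:R <= i.+1%:R * Y w] `\` [set w | v.+1%:R <= i.+1%:R * Y w]).
    by apply: measurableD; exact: measurable_ge.
  apply/seteqP; split => w /=.
    move=> <-; split; first by rewrite truncn_le mulr_ge0.
    by apply/negP; rewrite -ltNge truncnS_gt.
  by move=> [vl /negP]; rewrite -ltNge => vu; apply: truncn_def; rewrite vl.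
apply: measurable_fun_natP => v.
exact: (measurable_nat1 (fun t => (if (t < i.+1 ^ 2)%N then t else 0%N) = v)).
Qed.

Lemma law_ge0 i v : 0 <= law i v.
Proof.
case: v => [|v] /=; first by rewrite subr_ge0 invf_le1// ler1n.
by rewrite mulr_ge0 ?pr_ge0.
Qed.

Lemma law_sum i : \sum_(0 <= v < ncodes i) law i v = 1.
Proof.
rewrite /ncodes big_nat_recl//= -mulr_sumr.
rewrite (_ : \sum_(0 <= v < _) _ = 1) ?mulr1 ?subrK//.
rewrite -[RHS](pr_setT P').
rewrite (_ : setT = setT `&` [set w | (code i w < i.+1 ^ 2)%N]).
  rewrite pr_bigcupI//; last exact: measurable_code.
  by apply: eq_bigr => v _; rewrite setTI.
by apply/seteqP; split => w //= _; split => //; exact: code_lt.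
Qed.

Lemma tol_gt0 i : 0 < tol i.
Proof. by rewrite divr_gt0 ?exprn_gt0 ?invr_gt0 ?ltr0n. Qed.

Lemma tolM i : tol i * (ncodes i)%:R = 2^-1 ^+ i.+1.
Proof. by rewrite /tol divfK// pnatr_eq0. Qed.

Lemma tol_le i : tol i <= 2^-1 ^+ i.+1.
Proof. by rewrite -tolM ler_peMr// ?ler1n// ltW// tol_gt0. Qed.

Variables (V : nat -> X -> nat) (L : nat -> nat).
Hypothesis HV : forall i, [/\ measurable_fun [set: X] (V i), (forall x, (V i x < ncodes i)%N),
      (forall k v, (k <= i)%N -> (v < ncodes i)%N ->
        `|pr (zeros V k i `&` [set x | V i x = v]) - pr (zeros V k i) * law i v| <= tol i) &
      pr (moves T (L i) (V i)) <= tol i].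

Let mV i : measurable_fun [set: X] (V i). Proof. by have [] := HV i. Qed.

Let mz k i : measurable (zeros V k i). Proof. exact: measurable_zeros. Qed.

Lemma zerosS k i : (k <= i)%N -> zeros V k i.+1 = zeros V k i `&` [set x | V i x = 0%N].
Proof.
move=> ki; apply/seteqP; split => x /=.
  by move=> h; split => [l /andP[kl li]|]; apply: h; rewrite ?kl ?ki ?leqnn// ltnW.
move=> [h1 h2] l /andP[kl]; rewrite ltnS leq_eqVlt => /orP[/eqP->//|li].
by apply: h1; rewrite kl.
Qed.

Lemma pr_zerosS_le k i : (k <= i)%N ->
  pr (zeros V k i.+1) <= pr (zeros V k i) * (1 - i.+1%:R^-1) + tol i.
Proof.
move=> ki; rewrite zerosS//; have [_ _ /(_ k 0%N ki isT) + _] := HV i.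
by rewrite ler_distl => /andP[_].
Qed.

(** Without errors, the factors [1 - 1 / (j+1)] telescope to [k / i]. Over a quadratic horizon, a
    search that finds no renewal thus has probability of order [1 / k]. *)
Lemma pr_zeros_le k i : (k <= i)%N -> i%:R * pr (zeros V k i) <= k%:R + 1.
Proof.
(* The term [2^-i] absorbs the errors [tol j], multiplied by [j.+1], that accumulate in the
   induction. *)
move=> ki; suff : i%:R * pr (zeros V k i) <= k%:R + 1 - 2^-1 ^+ i.
  by move/le_trans; apply; rewrite lerBlDr lerDl exprn_ge0.
rewrite -(subnKC ki); elim: (i - k)%N => [|m IH].
  rewrite addn0; apply: (@le_trans _ _ k%:R).
    by rewrite ler_piMr// pr_le1.
  by rewrite -addrA lerDl subr_ge0 exprn_ile1// ?invr_ge0// invf_le1// ler1n.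
rewrite addnS; set j := (k + m)%N in IH *.
have kj : (k <= j)%N by exact: leq_addr.
have j0 : (0 : R) < j.+1%:R by rewrite ltr0n.
have := ler_wpM2l (ltW j0) (pr_zerosS_le kj).
rewrite mulrDr mulrCA mulrBr mulr1 divff ?gt_eqF// -{2}natr1 addrK mulrC [_ * j%:R]mulrC.
have : j.+1%:R * tol j <= 2^-1 ^+ j.+1.
  rewrite -tolM mulrC ler_pM2l ?tol_gt0// ler_nat /ncodes.
  by rewrite -[X in (X <= _)%N]expn1 leqW// leq_pexp2l.
have : 2^-1 ^+ j = 2^-1 ^+ j.+1 * 2 :> R by rewrite exprS; field.
by lra.
Qed.

Lemma pr_nonzero i : pr [set x | V i x <> 0%N] <= i.+1%:R^-1 + tol i.
Proof.
(* The empty range [k = i] turns the assumption on [zeros] into one on the law of [V i] alone. *)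
have zT : zeros V i i = setT.
  by apply/seteqP; split => x // _ l /andP[il li]; move: (leq_trans li il); rewrite ltnn.
have [_ _ /(_ i 0%N (leqnn i) isT) + _] := HV i.
rewrite zT setTI pr_setT mul1r ler_distl => /andP[h _].
have m0 : measurable [set x | V i x = 0%N] by exact: (measurable_nat1 (fun j => j = 0%N)).
have -> : [set x | V i x <> 0%N] = ~` [set x | V i x = 0%N] by [].
by rewrite (prC P m0) lerBlDr -lerBlDl opprD addrA.
Qed.

(* [phi i (V i x)] at the first renewal i of x in [k, G), and 0 if there is none
   (if [phi i 0 = 0]). *)
Definition renewed (phi : nat -> nat -> R) k G x : R :=
  \sum_(k <= i < G) \1_(zeros V k i) x * phi i (V i x).

Lemma first_renewal k G x : zeros V k G x \/
  exists i, [/\ (k <= i < G)%N, V i x <> 0%N & zeros V k i x].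
Proof.
elim: G => [|G [zG|[i [/andP[ki iG] Vi zi]]]].
- by left => l; rewrite ltn0 andbF.
- have [kG|Gk] := leqP k G; last first.
    by left => l /andP[kl lG]; move: (leq_trans (leq_ltn_trans kl lG) Gk); rewrite ltnn.
  have [V0|/eqP V0] := eqVneq (V G x) 0%N.
    by left; rewrite zerosS.
  by right; exists G; rewrite kG ltnSn.
- by right; exists i; rewrite ki ltnS ltnW.
Qed.

Lemma renewed_zeros phi k G x : (forall i, phi i 0%N = 0) ->
  zeros V k G x -> renewed phi k G x = 0.
Proof.
move=> phi0 zG; rewrite /renewed big_nat big1// => i ki.
by rewrite (zG i ki) phi0 mulr0.
Qed.

Lemma renewed_first phi k G i x : (forall i, phi i 0%N = 0) ->
  (k <= i < G)%N -> V i x <> 0%N -> zeros V k i x -> renewed phi k G x = phi i (V i x).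
Proof.
move=> phi0 kiG Vi zi; rewrite /renewed (bigD1_seq i)/= ?mem_index_iota ?iota_uniq//.
rewrite indicE mem_set//= mul1r big_seq_cond big1 ?addr0// => j.
rewrite mem_index_iota => /andP[/andP[kj jG] ji].
have [ij|ij] := ltnP i j.
  rewrite indicE memNset ?mul0r// => zj; apply: Vi; apply: zj.
  by move: kiG => /andP[-> _].
by rewrite (zi j) ?phi0 ?mulr0// kj ltn_neqAle ji.
Qed.

Lemma renewed_ext phi k G x y : (forall l, (k <= l < G)%N -> V l y = V l x) ->
  renewed phi k G y = renewed phi k G x.
Proof.
move=> yx; rewrite /renewed big_nat [RHS]big_nat; apply: eq_bigr => i /andP[ki iG].
rewrite yx ?ki// !indicE (_ : (y \in _) = (x \in zeros V k i))//.
by apply/idP/idP => /set_mem z; apply/mem_set => l /andP[kl li];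
  [rewrite -yx|rewrite yx]; rewrite ?kl ?(ltn_trans li)//; apply: z; rewrite kl.
Qed.

Lemma measurable_renewed phi k G : measurable_fun [set: X] (renewed phi k G).
Proof.
apply: measurable_sum => i; apply: measurable_funM.
  exact: (proj1 (bdd_meas_indic R (mz k i))).
exact: (measurable_fun_natR (phi i) (mV i)).
Qed.

(* Renewals are only looked for up to a horizon, past which none occurs with
   small probability; this keeps the renewal values bounded. *)
Definition horizon (k : nat) : nat := k.+2 ^ 2.

Definition renewal_value (k : nat) (x : X) : R := renewed value k (horizon k) x.

Lemma value0 i : value i 0 = 0.
Proof. by rewrite /value mul0r. Qed.

(** Codes at step [i] are below [i.+1 ^ 2], so the value carried is at most [i.+1], and [i] is below
    the horizon. *)
Lemma renewal_value_bound k x : 0 <= renewal_value k x <= (horizon k)%:R.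
Proof.
rewrite /renewal_value; have [z|[i [kiG Vi zi]]] := first_renewal k (horizon k) x.
  by rewrite (renewed_zeros value0 z) lexx ler0n.
rewrite (renewed_first value0 kiG Vi zi) /value divr_ge0//=.
rewrite ler_pdivrMr ?ltr0n// -natrM ler_nat.
have [_ /(_ x) + _ _] := HV i; rewrite /ncodes ltnS => Vlt.
move: kiG => /andP[_ iG].
apply: leq_trans (leq_pred _) (leq_trans Vlt _).
by rewrite -mulnn leq_mul2r.
Qed.

(** Without renewal at step [q.-1], the searches from [q.-1] and from [q] stop at the same renewal,
    provided that it lies within the shorter horizon; a point [y] with the same [V l] sees the same
    renewals. *)
Lemma renewal_value_stable q x y : (0 < q)%N -> V q.-1 x = 0%N -> ~ zeros V q (horizon q.-1) x ->
  (forall l, (q.-1 <= l < horizon q)%N -> V l y = V l x) ->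
  renewal_value q y = renewal_value q x /\ renewal_value q.-1 y = renewal_value q x.
Proof.
move=> q0 Vq zq yx.
have hh : (horizon q.-1 <= horizon q)%N by rewrite leq_exp2r// !ltnS leq_pred.
have E : renewal_value q x = renewal_value q.-1 x.
  rewrite /renewal_value; have [//|[i [/andP[qi iG] Vi zi]]] := first_renewal q (horizon q.-1) x.
  rewrite (renewed_first value0 _ Vi zi); last by rewrite qi (leq_trans iG).
  rewrite (renewed_first value0 _ Vi)//; first by rewrite iG (leq_trans (leq_pred q)).
  move=> l /andP[ql li]; have [ql'|lq] := leqP q l; first by apply: zi; rewrite ql'.
  by rewrite (_ : l = q.-1)//; lia.
split; first by apply: renewed_ext => l /andP[ql lG]; apply: yx; rewrite lG (leq_trans (leq_pred q)).
by rewrite E; apply: renewed_ext => l /andP[ql lG]; apply: yx; rewrite ql (leq_trans lG).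
Qed.

(** * Convergence in law of the renewal values to Y *)

Section law_of_W.
Variables (g : R -> R) (C : R).
Hypotheses (mg : measurable_fun [set: R] g) (gC : forall z, `|g z| <= C).
Hypothesis g_unif : forall e : R, 0 < e ->
  exists2 del : R, 0 < del & forall y z : R, `|y - z| < del -> `|g y - g z| <= e.

Let C0 : 0 <= C. Proof. exact: le_trans (normr_ge0 _) (gC 0). Qed.

Let bgY : bdd_meas (fun w => g (Y w)).
Proof. by split; [exact: measurableT_comp|exists C => w]. Qed.

Let bgcode i : bdd_meas (fun w => g ((code i w)%:R / i.+1%:R)).
Proof.
split; last by exists C => w.
exact: (measurable_fun_natR (fun v => g (v%:R / i.+1%:R)) (measurable_code i)).
Qed.

(** Where [Y] is below [i.+1], the truncation is inactive and the rounding error is less than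
    [1 / (i+1)]; the remaining event is rare because [Y] is finite. *)
Lemma code_cvg (e : R) : 0 < e -> exists i0, forall i, (i0 <= i)%N ->
  `|mean P' (fun w => g ((code i w)%:R / i.+1%:R)) - mean P' (fun w => g (Y w))| <= e.
Proof.
move=> e0.
have e2 : 0 < e / 2 by rewrite divr_gt0.
have [del del0 gdel] := g_unif e2.
pose F i := [set w | i.+1%:R <= Y w].
have mF i : measurable (F i) by exact: measurable_ge.
have dF i : F i.+1 `<=` F i by move=> w /=; apply: le_trans; rewrite ler_nat.
have F0 : \bigcap_i F i = set0.
  apply/seteqP; split => w // /(_ (Num.truncn (Y w)) I) /= h.
  by have := lt_le_trans (truncnS_gt (Y w)) h; rewrite ltxx.
have D0 : 0 < 4 * C + 1 by have := C0; lra.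
have e3 : 0 < e / (4 * C + 1) by rewrite divr_gt0.
have [i1] := pr_bigcap_approx P' e3 mF dF.
rewrite F0 pr_set0 add0r => Fi1.
pose i2 := Num.truncn (del^-1).
exists (maxn i1 i2) => i; rewrite geq_max => /andP[i1i i2i].
have Fi : prob P' (F i) < e / (4 * C + 1).
  apply: le_lt_trans Fi1; apply: le_pr => // w /=.
  by apply: le_trans; rewrite ler_nat ltnS.
have idel : i.+1%:R^-1 < del.
  rewrite invf_plt ?posrE ?ltr0n//; apply: lt_le_trans (truncnS_gt _) _.
  by rewrite ler_nat ltnS.
rewrite -expectB//; apply: le_trans (le_norm_expect P' _) _; first exact: bdd_measB.
apply: le_trans (expect_le_good P' (A := ~` F i) (e := e / 2) (C := 2 * C) _ _ _ _ _ _) _.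
- exact: ltW.
- by rewrite mulr_ge0.
- exact/bdd_meas_norm/bdd_measB.
- exact: measurableC.
- move=> w /negP; rewrite -ltNge => Yi; apply: gdel.
  have i0 : (0 : R) < i.+1%:R by rewrite ltr0n.
  have tl := truncn_le (i.+1%:R * Y w); have tg := truncnS_gt (i.+1%:R * Y w).
  rewrite mulr_ge0// in tl.
  have -> : code i w = Num.truncn (i.+1%:R * Y w).
    rewrite /code ifT// -(ltr_nat R); apply: le_lt_trans tl _.
    by rewrite natrX expr2 ltr_pM2l.
  set t := Num.truncn _ in tl tg *.
  have h1 : t%:R / i.+1%:R <= Y w by rewrite ler_pdivrMr// mulrC.
  have h2 : Y w < t%:R / i.+1%:R + i.+1%:R^-1.
    by rewrite -[X in _ + X]mul1r -mulrDl natr1 ltr_pdivlMr// mulrC.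
  move: h1 h2 idel; move: (i.+1%:R^-1) => a h1 h2 ia.
  by rewrite ler0_norm; lra.
- by move=> w; apply: le_trans (ler_normB _ _) _; have := gC (Y w); have := gC ((code i w)%:R / i.+1%:R); lra.
- rewrite setCK; have : (4 * C + 1) * prob P' (F i) <= e.
    by rewrite mulrC -ler_pdivlMr ?ltW.
  by have := pr_ge0 P' (F i); lra.
Qed.

(** Decomposition along the first renewal. Once [g] is centred at [c], a first renewal at step [i]
    contributes [pr (zeros V q i) / i.+1] times the small error of [code_cvg], up to the tolerances;
    these weights have sum at most 2, and the event without renewal has probability of order
    [1 / q]. *)
Lemma renewal_value_law (e : R) : 0 < e -> exists q0, forall q, (q0 <= q)%N ->
  `|expect (fun x => g (renewal_value q x)) - mean P' (fun w => g (Y w))| <= e.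
Proof.
move=> e0.
have e4 : 0 < e / 4 by rewrite divr_gt0.
have [i0 Hi0] := code_cvg e4.
set c := mean P' _.
have cC : `|c| <= C.
  apply: le_trans (le_norm_expect _ _) _ => //; rewrite -[leRHS](expect_cst P').
  by apply: le_expect => //; [exact: bdd_meas_norm|exact: bdd_meas_cst].
pose h z := g z - c.
have hC z : `|h z| <= 2 * C by apply: le_trans (ler_normB _ _) _; have := gC z; lra.
pose phi i v := if v is v'.+1 then h (value i v) else 0.
have phi0 i : phi i 0%N = 0 by [].
have phiC i v : `|phi i v| <= 2 * C by case: v => [|v]//=; rewrite normr0 mulr_ge0.
(* Without renewal [renewed phi] is 0, whereas [h (renewal_value q x)] is [h 0]; hence the second
   term. *)
have hW q x : h (renewal_value q x) = renewed phi q (horizon q) x + h 0 * \1_(zeros V q (horizon q)) x.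
  rewrite /renewal_value; have [z|[i [qi Vi zi]]] := first_renewal q (horizon q) x.
    by rewrite (renewed_zeros value0 z) (renewed_zeros phi0 z) indicE mem_set//= mulr1 add0r.
  rewrite (renewed_first value0 qi Vi zi) (renewed_first phi0 qi Vi zi).
  rewrite indicE memNset; first by rewrite mulr0 addr0; case: (V i x) Vi.
  by move=> z; apply: Vi; exact: z.
have bphi q i : bdd_meas (fun x => \1_(zeros V q i) x * phi i (V i x)).
  apply: bdd_measM; first exact: bdd_meas_indic.
  by split; [exact: measurable_fun_natR|exists (2 * C)].
have step q i : (maxn i0 q <= i)%N -> `|expect (fun x => \1_(zeros V q i) x * phi i (V i x))| <=
    2 * C * 2^-1 ^+ i.+1 + e / 4 * (pr (zeros V q i) / i.+1%:R).
  rewrite geq_max => /andP[i0i qi]; have [_ Vlt Vp _] := HV i.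
  rewrite (expect_natfunI P _ (mz q i) (mV i) Vlt).
  have S1 : `|\sum_(0 <= v < ncodes i) phi i v * pr (zeros V q i `&` [set x | V i x = v])
      - \sum_(0 <= v < ncodes i) phi i v * (pr (zeros V q i) * law i v)| <= 2 * C * 2^-1 ^+ i.+1.
    rewrite -sumrB; apply: le_trans (ler_norm_sum _ _ _) _.
    have -> : 2 * C * 2^-1 ^+ i.+1 = \sum_(0 <= v < ncodes i) 2 * C * tol i.
      by rewrite big_const_nat subn0 iter_addr_0 -[RHS]mulr_natr -[RHS]mulrA tolM.
    rewrite big_nat [leRHS]big_nat; apply: ler_sum => v /andP[_ vr].
    by rewrite -mulrBr normrM ler_pM//; exact: Vp.
  have S2 : \sum_(0 <= v < ncodes i) phi i v * (pr (zeros V q i) * law i v) =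
      pr (zeros V q i) / i.+1%:R * (mean P' (fun w => g ((code i w)%:R / i.+1%:R)) - c).
    rewrite -[X in _ * (_ - X)](expect_cst P') -expectB//; last exact: bdd_meas_cst.
    have -> : mean P' (fun w => g ((code i w)%:R / i.+1%:R) - c) =
        \sum_(0 <= v < i.+1 ^ 2) h (v%:R / i.+1%:R) * prob P' [set w | code i w = v].
      rewrite (eq_bigr (fun v => h (v%:R / i.+1%:R) * prob P' (setT `&` [set w | code i w = v]))); last first.
        by move=> v _; rewrite setTI.
      rewrite -(expect_natfunI P' (fun v => h (v%:R / i.+1%:R)) measurableT (measurable_code i) (code_lt i)).
      congr (mean P' _); apply/funext => w.
      by rewrite indicT mul1r.
    rewrite /ncodes big_nat_recl//= mul0r add0r mulr_sumr; apply: eq_bigr => v _.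
    by rewrite /value /=; ring.
  rewrite -[X in `|X|](subrK (\sum_(0 <= v < ncodes i) phi i v * (pr (zeros V q i) * law i v))).
  apply: le_trans (ler_normD _ _) _; apply: lerD => //.
  rewrite S2 normrM ger0_norm ?divr_ge0 ?pr_ge0// mulrC.
  by rewrite ler_wpM2r ?divr_ge0 ?pr_ge0//; exact: Hi0.
(* Each weight is at most the decrease of [pr (zeros V q i)] from [i] to [i.+1], up to [tol i], and
   the decreases telescope. *)
have mass q G : (q <= G)%N ->
    \sum_(q <= i < G) (pr (zeros V q i) / i.+1%:R) <= 1 - pr (zeros V q G) + \sum_(q <= i < G) 2^-1 ^+ i.+1.
  elim: G => [|G IH].
    by rewrite leqn0 => /eqP->; rewrite !big_geq// addr0 subr_ge0 pr_le1.
  rewrite leq_eqVlt => /orP[/eqP <-|].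
    by rewrite !big_geq// addr0 subr_ge0 pr_le1.
  rewrite ltnS => qG; rewrite !big_nat_recr//=.
  have := IH qG; have := pr_zerosS_le qG; have := tol_le G.
  by move: (G.+1%:R^-1) (2^-1 ^+ G.+1) => a b; rewrite mulrBr mulr1; lra.
have geo q G : \sum_(q <= i < G) (2^-1 ^+ i.+1 : R) <= 2^-1 ^+ q.
  have [Gq|qG] := leqP G q; first by rewrite big_geq// exprn_ge0.
  suff : \sum_(q <= i < G) (2^-1 ^+ i.+1 : R) <= 2^-1 ^+ q - 2^-1 ^+ G.
    by move/le_trans; apply; rewrite lerBlDr lerDl exprn_ge0.
  elim: G qG => // G IH; rewrite ltnS leq_eqVlt => /orP[/eqP <-|qG].
    by rewrite big_nat1 exprS; lra.
  rewrite big_nat_recr/= ?(ltnW qG)//; have := IH qG.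
  by rewrite exprS; lra.
pose q1 := (Num.truncn (16 * C / e)).+1.
have q1P q : (q1 <= q)%N -> 16 * C <= e * q%:R.
  move=> q1q; rewrite [leRHS]mulrC -ler_pdivrMr//; apply: le_trans (ltW (truncnS_gt _)) _.
  by rewrite ler_nat.
exists (maxn i0 q1) => q; rewrite geq_max => /andP[i0q q1q].
have q0 : (0 < q)%N by exact: leq_trans q1q.
have qh : (q <= horizon q)%N by rewrite /horizon -mulnn; lia.
have bgW : bdd_meas (fun x => g (renewal_value q x)).
  by split; [exact: measurableT_comp (measurable_renewed _ _ _)|exists C].
rewrite -[X in _ - X](expect_cst P) -expectB//; last exact: bdd_meas_cst.
rewrite (_ : (fun x => _) = (fun x => renewed phi q (horizon q) x + h 0 * \1_(zeros V q (horizon q)) x)); last first.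
  by apply/funext => x; exact: hW.
have bI : bdd_meas (fun x => h 0 * \1_(zeros V q (horizon q)) x : R).
  exact/bdd_measZ/bdd_meas_indic.
rewrite expectD//; last by apply: bdd_meas_sum => i _; exact: bphi.
rewrite expect_sum; last by move=> i _; exact: bphi.
rewrite expectZ ?expect_indic//; last exact: bdd_meas_indic.
have T1 : `|\sum_(q <= i < horizon q) expect (fun x => \1_(zeros V q i) x * phi i (V i x))|
    <= 2 * C * 2^-1 ^+ q + e / 4 * 2.
  apply: le_trans (ler_norm_sum _ _ _) _.
  apply: (@le_trans _ _ (\sum_(q <= i < horizon q) (2 * C * 2^-1 ^+ i.+1 + e / 4 * (pr (zeros V q i) / i.+1%:R)))).
    rewrite big_nat [leRHS]big_nat; apply: ler_sum => i /andP[qi _].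
    by apply: step; rewrite geq_max (leq_trans i0q).
  rewrite big_split/= -!mulr_sumr; apply: lerD.
    by rewrite ler_wpM2l ?mulr_ge0.
  apply: ler_wpM2l; first exact: ltW.
  apply: le_trans (mass _ _ qh) _.
  have := geo q (horizon q); have := pr_ge0 P (zeros V q (horizon q)).
  have : (2^-1 : R) ^+ q <= 1 by rewrite exprn_ile1// ?invr_ge0// invf_le1// ler1n.
  by lra.
have T2 : `|h 0 * pr (zeros V q (horizon q))| <= 2 * C / q.+1%:R.
  rewrite normrM (ger0_norm (pr_ge0 _ _)); apply: ler_pM => //; first exact: pr_ge0.
  rewrite -[leRHS]div1r ler_pdivlMr ?ltr0n//.
  have := pr_zeros_le qh; rewrite natr1.
  have h1 : (q.+1%:R : R) ^+ 2 <= (horizon q)%:R by rewrite -natrX ler_nat leq_exp2r.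
  have h2 : (0 : R) < q.+1%:R by rewrite ltr0n.
  move=> h3; rewrite -(ler_pM2r h2) mul1r; apply: le_trans h3.
  by rewrite -mulrA mulrC -expr2 ler_wpM2r// pr_ge0.
have h2q : (2^-1 : R) ^+ q <= q.+1%:R^-1.
  rewrite exprVn lef_pV2 ?posrE ?exprn_gt0 ?ltr0n// -natrX ler_nat.
  exact: ltn_expl.
have hq : 2 * C / q.+1%:R <= e / 8.
  rewrite ler_pdivrMr ?ltr0n//; have := q1P _ q1q; rewrite -natr1; lra.
have h3 : 2 * C * 2^-1 ^+ q <= 2 * C / q.+1%:R by rewrite ler_wpM2l// mulr_ge0.
have T1' := le_trans T1 (lerD (le_trans h3 hq) (lexx _)).
have T2' := le_trans T2 hq.
apply: le_trans (ler_normD _ _) (le_trans (lerD T1' T2') _).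
by lra.
Qed.

End law_of_W.
End renewal.

(** * The norming function *)

Section norming.
Context (R : realType).
Implicit Types (t x : R).

(** The ratios of consecutive terms, [2 ^ (j + j.+1)], tend to infinity: multiplying a large [t] by
    a constant moves it by at most one interval, the terms before [scale k] have sum at most
    [scale k], and an orbit of length [scale k.+1] rarely meets the levels from [k.+2] on. *)
Definition scale (j : nat) : nat := (2 ^ (j ^ 2))%N.

Lemma scale_gt0 j : (0 < scale j)%N.
Proof. by rewrite expn_gt0. Qed.

Lemma scale_gt j : (j < scale j)%N.
Proof.
apply: leq_ltn_trans (ltn_expl (j ^ 2) (ltnSn 1)).
by case: j => // j; rewrite leq_pmull.
Qed.

Lemma leq_scale i j : (i <= j)%N -> (scale i <= scale j)%N.
Proof. by move=> ij; rewrite leq_exp2l// leq_sqr. Qed.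

Lemma scaleS j : (scale j.+1 = scale j * 2 ^ (j + j.+1))%N.
Proof. by rewrite /scale -expnD; congr (_ ^ _)%N; rewrite -!mulnn; lia. Qed.

Lemma sum_scale k : (\sum_(0 <= j < k) scale j <= scale k)%N.
Proof.
elim: k => [|k IH]; first by rewrite big_geq.
rewrite big_nat_recr//= scaleS addnS expnS.
apply: leq_trans (leq_add IH (leqnn _)) _; rewrite addnn -mul2n mulnCA leq_mul2l/=.
by rewrite leq_pmulr// expn_gt0.
Qed.

(* The slope of this piecewise linear function increases by 1 at each point
   [scale j]; it is about j on the j-th of these intervals. *)
Definition norming t : R :=
  t + \sum_(0 <= j < (Num.truncn t).+1) Num.max 0 (t - (scale j)%:R).

(** As [j < scale j], the terms of index above [t] vanish. The cut-off can thus be raised, and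
    values at several points compared on the same sum. *)
Lemma normingE t N : (Num.truncn t < N)%N ->
  norming t = t + \sum_(0 <= j < N) Num.max 0 (t - (scale j)%:R).
Proof.
move=> tN; rewrite /norming; congr (_ + _).
rewrite [RHS](big_cat_nat _ tN)//= [X in _ + X]big_nat [X in _ + X]big1 ?addr0// => j /andP[tj _].
apply/max_idPl; rewrite subr_le0; apply: le_trans (ltW (truncnS_gt t)) _.
by rewrite ler_nat (leq_trans tj)// ltnW// scale_gt.
Qed.

Lemma window t : 1 <= t -> exists k, (scale k)%:R <= t < (scale k.+1)%:R.
Proof.
move=> t1.
have ex : exists k, t < (scale k.+1)%:R.
  exists (Num.truncn t); apply: lt_le_trans (truncnS_gt t) _.
  by rewrite ler_nat ltnW// scale_gt.
exists (ex_minn ex); case: ex_minnP => k tk mink; rewrite tk andbT.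
case: k tk mink => [|k] tk mink; first by rewrite /scale expn0.
by rewrite leNgt; apply/negP => /mink; rewrite ltnn.
Qed.

(** On this interval only the terms [j <= k] matter, which gives [(k + 2) t] minus the sum of the
    [scale j], [j <= k]; that sum is at most [2 * scale k], hence at most [2 t]. *)
Lemma norming_window t k : (scale k)%:R <= t < (scale k.+1)%:R ->
  k%:R * t <= norming t <= (k%:R + 2) * t.
Proof.
move=> /andP[kt tk].
pose N := maxn (Num.truncn t).+1 k.+1.
rewrite (@normingE t N) ?leq_max ?leqnn//.
have kN : (k.+1 <= N)%N by rewrite leq_max leqnn orbT.
rewrite (big_cat_nat _ kN)//=.
rewrite [X in _ + (_ + X)]big_nat [X in _ + (_ + X)]big1 ?addr0; last first.
  move=> j /andP[kj _]; apply/max_idPl; rewrite subr_le0; apply: le_trans (ltW tk) _.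
  by rewrite ler_nat leq_scale.
have maxE j : (j <= k)%N -> Num.max 0 (t - (scale j)%:R) = t - (scale j)%:R.
  move=> jk; apply/max_idPr; rewrite subr_ge0; apply: le_trans kt.
  by rewrite ler_nat leq_scale.
rewrite big_nat_recr//= maxE//.
rewrite (eq_big_nat _ _ (F2 := fun j => t - (scale j)%:R)); last first.
  by move=> j /andP[_ /ltnW]; exact: maxE.
rewrite sumrB big_const_nat subn0 iter_addr_0 -natr_sum -[t *+ k]mulr_natl.
have : (\sum_(0 <= j < k) scale j)%:R <= (scale k)%:R :> R by rewrite ler_nat sum_scale.
have : (0 : R) <= (\sum_(0 <= j < k) scale j)%:R by rewrite ler0n.
have : (0 : R) <= (scale k)%:R by rewrite ler0n.
move: (\sum_(0 <= j < k) scale j)%:R (scale k)%:R kt => a b kt b0 a0 ab.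
by apply/andP; split; lra.
Qed.

Lemma norming_gt0 t : 0 < t -> 0 < norming t.
Proof.
move=> t0; rewrite ltr_pwDl// sumr_ge0// => j _.
by rewrite le_max lexx.
Qed.

Lemma norming_convex : convex_function (`]0, +oo[%classic : set R) norming.
Proof.
move=> l x y _ _.
have l0 : 0 <= l%:num :> R by [].
have l1 : l%:num <= 1 :> R by [].
have -> : conv l x y = l%:num * x + (1 - l%:num) * y by [].
have -> : conv l (norming x : R^o) (norming y) =
  l%:num * norming x + (1 - l%:num) * norming y by [].
move: (l%:num) l0 l1 => a l0 l1; set z := a * x + _.
pose N := (maxn (Num.truncn z) (maxn (Num.truncn x) (Num.truncn y))).+1.
rewrite (@normingE z N) ?ltnS ?leq_max ?leqnn//.
rewrite (@normingE x N) ?ltnS ?leq_max ?leqnn ?orbT//.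
rewrite (@normingE y N) ?ltnS ?leq_max ?leqnn ?orbT//.
suff : \sum_(0 <= j < N) Num.max 0 (z - (scale j)%:R) <=
    a * (\sum_(0 <= j < N) Num.max 0 (x - (scale j)%:R)) +
    (1 - a) * (\sum_(0 <= j < N) Num.max 0 (y - (scale j)%:R)).
  rewrite /z; lra.
rewrite !mulr_sumr -big_split/=; apply: ler_sum => j _.
have a1 : 0 <= 1 - a by rewrite subr_ge0.
have mx : x - (scale j)%:R <= Num.max 0 (x - (scale j)%:R) by rewrite le_max lexx orbT.
have my : y - (scale j)%:R <= Num.max 0 (y - (scale j)%:R) by rewrite le_max lexx orbT.
have mx0 : 0 <= Num.max 0 (x - (scale j)%:R) by rewrite le_max lexx.
have my0 : 0 <= Num.max 0 (y - (scale j)%:R) by rewrite le_max lexx.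
rewrite ge_max; apply/andP; split; first by rewrite addr_ge0// mulr_ge0.
have := ler_wpM2l l0 mx; have := ler_wpM2l a1 my; rewrite /z; lra.
Qed.

(** For large [t], the intervals of [t] and [x * t] have indices that differ by at most 1. So
    [norming (x * t)] and [x * norming t] differ by at most [3 x t], to be compared with
    [norming t >= k t]. *)
Lemma norming_regular : regularly_varying 1 norming.
Proof.
move=> x x0; rewrite powRr1 ?ltW//.
apply/cvgrPdist_le => e e0.
have bigk (a : R) m : (Num.truncn a <= m)%N -> a <= m.+1%:R.
  by move=> am; apply: le_trans (ltW (truncnS_gt a)) _; rewrite ler_nat ltnS.
have [k0 [k00 k0x k0x' k0e]] : exists k0, [/\ (0 < k0)%N,
    x <= k0%:R, x^-1 <= k0%:R & 3 * x / e <= k0%:R].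
  exists (Num.truncn x + Num.truncn x^-1 + Num.truncn (3 * x / e)).+1; split; first by rewrite ltnS.
  - by apply: bigk; rewrite -addnA leq_addr.
  - by apply: bigk; rewrite addnAC leq_addl.
  - by apply: bigk; rewrite leq_addl.
exists ((scale k0)%:R); split; first exact: num_real.
move=> t /ltW k0t.
have t0 : 0 < t by apply: lt_le_trans k0t; rewrite ltr0n scale_gt0.
have [k kt] : exists k, (scale k)%:R <= t < (scale k.+1)%:R.
  by apply: window; apply: le_trans k0t; rewrite ler1n scale_gt0.
have /andP[kt1 kt2] := kt.
have k0k : (k0 <= k)%N.
  rewrite leqNgt; apply/negP => kk0; have := le_lt_trans k0t kt2.
  by rewrite ltNge ler_nat leq_scale.
have kpos : (0 < k)%N by exact: leq_trans k0k.
have kR : (0 : R) < k%:R by rewrite ltr0n.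
have p2 m : (k0 <= m)%N -> (k0%:R : R) <= (2 ^ m)%:R.
  by move=> km; rewrite ler_nat (leq_trans km)// ltnW// ltn_expl.
have xt_hi : x * t < (scale k.+2)%:R.
  rewrite scaleS natrM mulrC ltr_pM ?ltW//.
  apply: le_lt_trans k0x (le_lt_trans (p2 k0 (leqnn _)) _).
  by rewrite ltr_nat ltn_exp2l//; clear -k0k; lia.
have xt_lo : (scale k.-1)%:R <= x * t.
  have : (scale k.-1)%:R * x^-1 <= t.
    apply: le_trans kt1; rewrite -{2}(prednK kpos) scaleS natrM ler_pM2l ?ltr0n ?scale_gt0//.
    by apply: le_trans k0x' (p2 _ _); clear -k0k; lia.
  by rewrite ler_pdivrMr// mulrC.
have [k' k't] : exists k', (scale k')%:R <= x * t < (scale k'.+1)%:R.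
  by apply: window; apply: le_trans xt_lo; rewrite ler1n scale_gt0.
have /andP[k't1 k't2] := k't.
have k'hi : (k' <= k.+1)%N.
  rewrite leqNgt; apply/negP => h; have := le_lt_trans k't1 xt_hi.
  by rewrite ltNge ler_nat leq_scale.
have k'lo : (k.-1 <= k')%N.
  rewrite leqNgt; apply/negP => h; have := le_lt_trans xt_lo k't2.
  by rewrite ltNge ler_nat leq_scale.
have /andP[b1 b2] := norming_window kt.
have /andP[b3 b4] := norming_window k't.
have bt0 := norming_gt0 t0.
have k'hiR : k'%:R <= k%:R + 1 :> R by rewrite natr1 ler_nat.
have k'loR : k%:R - 1 <= k'%:R :> R by rewrite lerBlDr natr1 ler_nat -(prednK kpos) ltnS.
have xt0 : 0 < x * t by rewrite mulr_gt0.
have b5 : norming (x * t) <= (k%:R + 3) * (x * t).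
  by apply: le_trans b4 _; rewrite ler_pM2r//; lra.
have b6 : (k%:R - 1) * (x * t) <= norming (x * t).
  by apply: le_trans b3; rewrite ler_pM2r.
have k3 : 3 * x <= e * k%:R.
  rewrite [leRHS]mulrC -ler_pdivrMr//; apply: le_trans k0e _.
  by rewrite ler_nat.
have k3t : 3 * x * t <= e * norming t.
  apply: (@le_trans _ _ (e * k%:R * t)); first by rewrite ler_pM2r.
  by rewrite -mulrA ler_pM2l.
rewrite distrC ler_distl; apply/andP; split.
  rewrite ler_pdivlMr//.
  have : x * norming t <= x * ((k%:R + 2) * t) by rewrite ler_pM2l.
  by lra.
rewrite ler_pdivrMr//.
have : x * (k%:R * t) <= x * norming t by rewrite ler_pM2l.
by lra.
Qed.

End norming.

(** * The density and its ergodic sums *)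

Section towers.
Context d (X : measurableType d) (R : realType) (T : X -> X).
Variables (r : nat -> X -> nat) (D : nat -> X -> R).
Hypothesis rT : forall j x, (0 < r j x)%N -> r j (T x) = (r j x).-1.
Hypothesis D_ge0 : forall j x, 0 <= D j x.

(** After the value 0 the countdown may restart anywhere; not counting 0 as a visit keeps the visits
    of an orbit at least [scale j] steps apart. *)
Definition visit (j : nat) (x : X) : bool := (0 < r j x)%N && (scale j %| r j x)%N.

Definition visits (j n : nat) (x : X) : nat := (\sum_(0 <= i < n) visit j (iter i T x))%N.

Lemma visitsS j n x : visits j n.+1 x = (visit j x + visits j n (T x))%N.
Proof.
rewrite /visits big_nat_recl//=; congr (_ + _)%N.
by apply: eq_bigr => i _; rewrite -iterSr.
Qed.

(** The residue of [r j] modulo [scale j] is the time left before the next multiple. Added to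
    [scale j] times the count, it gives a quantity that the induction can compare with the elapsed
    time, also across restarts. *)
Lemma visits_le j n x : (scale j * visits j n x + r j x %% scale j < n + scale j)%N.
Proof.
have s0 := scale_gt0 j.
elim: n x => [|n IH] x.
  by rewrite /visits big_geq// muln0 add0n ltn_pmod.
rewrite visitsS mulnDr /visit; have := IH (T x).
case: (posnP (r j x)) => [->|r0] /=; first by rewrite mod0n muln0; lia.
rewrite (rT r0); move: r0; case: (r j x) => // t _ /=.
rewrite -/(dvdn _ _) modnS; case: ifP => ts; last by rewrite /= muln0; lia.
move/dvdnP : ts => [[//|m] tm].
have -> : (t %% scale j = (scale j).-1)%N.
  rewrite (_ : t = m * scale j + (scale j).-1)%N; first by rewrite modnMDl modn_small ?prednK.
  by move: tm s0; rewrite mulSn; lia.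
by rewrite /= muln1; lia.
Qed.

(** As the countdown does not run out before time [n], every multiple of [scale j] met on the way is
    a visit. *)
Lemma visits_ge j n x : (n <= r j x)%N -> (n <= scale j * visits j n x + r j x %% scale j)%N.
Proof.
have s0 := scale_gt0 j.
elim: n x => [//|n IH] x nr.
have r0 : (0 < r j x)%N by exact: leq_ltn_trans nr.
rewrite visitsS mulnDr /visit r0 /=.
have := IH (T x); rewrite (rT r0); move: nr r0; case: (r j x) => // t nt _ /= /(_ nt).
rewrite -/(dvdn _ _) modnS; case: ifP => ts; last by rewrite /= muln0; lia.
by rewrite /= muln1; have := ltn_pmod t s0; lia.
Qed.

(* [fine] sends a divergent sum to 0. *)
Definition density (x : X) : R :=
  1 + fine (\sum_(0 <= j <oo) ((scale j)%:R * (visit j x)%:R * D j x)%:E)%E.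

Let term_ge0 j x : 0 <= (scale j)%:R * (visit j x)%:R * D j x.
Proof. by rewrite !mulr_ge0. Qed.

Lemma density_gt0 x : 0 < density x.
Proof.
rewrite ltr_pwDl//; apply: fine_ge0; apply: nneseries_ge0 => j _ _.
by rewrite lee_fin.
Qed.

Lemma densityE m x : (forall j, (m <= j)%N -> ~~ visit j x) ->
  density x = 1 + \sum_(0 <= j < m) (scale j)%:R * (visit j x)%:R * D j x.
Proof.
move=> nv; rewrite /density; congr (1 + _).
rewrite (_ : (\sum_(0 <= j <oo) _)%E =
    (\sum_(0 <= j < m) (scale j)%:R * (visit j x)%:R * D j x)%:E)//.
apply/cvg_lim => //.
apply: cvg_near_cst; near=> n.
have mn : (m <= n)%N by near: n; exact: nbhs_infty_ge.
rewrite sumEFin (big_cat_nat _ mn)//= [X in _ + X]big_nat [X in _ + X]big1 ?addr0// => j /andP[mj _].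
by rewrite (negbTE (nv _ mj)) mulr0 mul0r.
Unshelve. all: by end_near. Qed.

Lemma measurable_density : (forall j, measurable_fun [set: X] (r j)) ->
  (forall j, measurable_fun [set: X] (D j)) -> measurable_fun [set: X] density.
Proof.
move=> mr mD; apply: measurable_funD => //.
apply: measurableT_comp => //.
apply: ge0_emeasurable_sum => [j x _ _|j _]; first by rewrite lee_fin.
apply/measurable_EFinP; apply: measurable_funM => //; apply: measurable_funM => //.
exact: (measurable_fun_natR (fun t => ((0 < t)%N && (scale j %| t)%N)%:R) (mr j)).
Qed.

(* The contributions of the levels j < c are bounded crudely, those of the levels
   c <= j < k are computed, and the levels k and k.+1 are again bounded crudely. *)
Lemma birkhoff_density (n k c : nat) (M w : R) (x : X) :
  (scale k <= n < scale k.+1)%N -> (0 < c)%N -> (c ^ 2 <= k)%N -> 1 <= M -> 0 <= w <= M ->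
  (forall i j, (j <= k.+1)%N -> D j (iter i T x) <= M) ->
  (forall i j, (i < n)%N -> (k.+2 <= j)%N -> ~~ visit j (iter i T x)) ->
  ((scale k.+1 <= c * n)%N \/ forall i, (i < n)%N -> ~~ visit k.+1 (iter i T x)) ->
  (forall j, (c <= j < k)%N -> (n <= r j x)%N) ->
  (forall i j, (i < n)%N -> (c <= j <= k)%N -> D j (iter i T x) = w) ->
  `|(norming n%:R)^-1 * \sum_(0 <= i < n) density (iter i T x) - w| <= 10 * M / c%:R.
Proof.
move=> /andP[kn nk] c0 ck M1 /andP[w0 wM] DM H1 H2 H3 H4.
have n0 : (0 < n)%N by exact: leq_trans (scale_gt0 k) kn.
have ck' : (c <= k)%N by apply: leq_trans ck; rewrite -mulnn leq_pmulr.
have k0 : (0 < k)%N by exact: leq_trans ck'.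
pose term j : R := \sum_(0 <= i < n) (scale j)%:R * (visit j (iter i T x))%:R * D j (iter i T x).
have -> : \sum_(0 <= i < n) density (iter i T x) = n%:R + \sum_(0 <= j < k.+2) term j.
  rewrite /term exchange_big/= big_nat.
  rewrite (eq_bigr (fun i => 1 + \sum_(0 <= j < k.+2)
    (scale j)%:R * (visit j (iter i T x))%:R * D j (iter i T x))); last first.
    by move=> i /andP[_ iN]; apply: densityE => j kj; exact: H1.
  by rewrite -big_nat big_split/= big_const_nat subn0 iter_addr_0.
have visitsE j : \sum_(0 <= i < n) (scale j)%:R * (visit j (iter i T x))%:R
    = (scale j * visits j n x)%:R :> R.
  by rewrite natrM /visits natr_sum mulr_sumr.
have vle j : (scale j * visits j n x)%:R <= n%:R + (scale j)%:R :> R.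
  by rewrite -natrD ler_nat; have := visits_le j n x; clear; lia.
have term0 j : 0 <= term j by apply: sumr_ge0.
have termM j : (j <= k.+1)%N -> term j <= M * (n%:R + (scale j)%:R).
  move=> jk; apply: (@le_trans _ _ (M * (scale j * visits j n x)%:R)); last first.
    by rewrite ler_wpM2l// (le_trans ler01).
  rewrite -visitsE mulr_sumr; apply: ler_sum => i _.
  by rewrite [leRHS]mulrC ler_wpM2l ?mulr_ge0// DM.
have termw j : (c <= j <= k)%N -> term j = w * (scale j * visits j n x)%:R.
  move=> cjk; rewrite -visitsE mulr_sumr /term big_nat [RHS]big_nat.
  by apply: eq_bigr => i /andP[_ iN]; rewrite H4// mulrC.
have scn j : (j <= k)%N -> (scale j)%:R <= n%:R :> R.
  by move=> jk; rewrite ler_nat (leq_trans _ kn)// leq_scale.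
have M0 : 0 <= M by exact: le_trans M1.
rewrite big_nat_recr// big_nat_recr//= (big_cat_nat _ ck')//=.
have s1 : 0 <= \sum_(0 <= j < c) term j <= 2 * (c%:R * n%:R * M).
  rewrite sumr_ge0//=.
  have -> : 2 * (c%:R * n%:R * M) = \sum_(0 <= j < c) 2 * (n%:R * M).
    by rewrite big_const_nat subn0 iter_addr_0 -mulr_natr; ring.
  rewrite big_nat [leRHS]big_nat; apply: ler_sum => j /andP[_ jc].
  have jk : (j <= k)%N by apply: ltnW; exact: leq_trans ck'.
  apply: le_trans (termM j (leqW jk)) _.
  have := ler_wpM2l M0 (scn j jk); lra.
(* The errors in [scale j] times the visit counts, at most [scale j] each, add up to at most [n]. *)
have sumsc : 0 <= (\sum_(c <= j < k) (scale j)%:R : R) <= n%:R.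
  rewrite sumr_ge0//= -natr_sum ler_nat.
  apply: leq_trans _ (leq_trans (sum_scale k) kn).
  by rewrite [leqRHS](big_cat_nat _ ck')//= leq_addl.
have cst (a : R) : \sum_(c <= j < k) a = k%:R * a - c%:R * a.
  by rewrite big_const_nat iter_addr_0 -[LHS]mulr_natl natrB// mulrBl.
have s2 : k%:R * (n%:R * w) - c%:R * (n%:R * w) - n%:R * w <= \sum_(c <= j < k) term j
    <= k%:R * (n%:R * w) - c%:R * (n%:R * w) + n%:R * w.
  have -> : \sum_(c <= j < k) term j = w * \sum_(c <= j < k) (scale j * visits j n x)%:R.
    rewrite mulr_sumr big_nat [RHS]big_nat; apply: eq_bigr => j /andP[cj jk].
    by rewrite termw// cj ltnW.
  have up : \sum_(c <= j < k) (scale j * visits j n x)%:R <= k%:R * n%:R - c%:R * n%:R + n%:R :> R.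
    have /andP[_ h] := sumsc; apply: le_trans (lerD (lexx _) h).
    by rewrite -cst -big_split/=; apply: ler_sum => j _; exact: vle.
  have lo : k%:R * n%:R - c%:R * n%:R - n%:R <= \sum_(c <= j < k) (scale j * visits j n x)%:R :> R.
    have /andP[_ h] := sumsc; rewrite lerBlDr; apply: le_trans (lerD (lexx _) h).
    rewrite -cst -big_split/= big_nat [leRHS]big_nat; apply: ler_sum => j /andP[cj jk].
    rewrite -natrD ler_nat; apply: leq_trans (visits_ge (H3 j _)) _; first by rewrite cj.
    by rewrite leq_add2l ltnW// ltn_pmod// scale_gt0.
  by have := ler_wpM2l w0 up; have := ler_wpM2l w0 lo; move=> h1 h2; apply/andP; split; lra.
have s3 : 0 <= term k <= 2 * (n%:R * M).
  rewrite term0/=; apply: le_trans (termM k (leqnSn k)) _.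
  have := ler_wpM2l M0 (scn k (leqnn k)); lra.
have cR : (1 : R) <= c%:R by rewrite ler1n.
have nR : (0 : R) < n%:R by rewrite ltr0n.
have nM : 0 <= n%:R * M by rewrite mulr_ge0.
have cnM : n%:R * M <= c%:R * n%:R * M by rewrite -mulrA ler_peMl.
(* Either [scale k.+1] is at most [c * n], and the crude bound is of order [c * n * M], or this
   level is not met at all. *)
have s4 : 0 <= term k.+1 <= 2 * (c%:R * n%:R * M).
  rewrite term0/=; case: H2 => [h|h].
    apply: le_trans (termM k.+1 (leqnn _)) _.
    have h' : (scale k.+1)%:R <= c%:R * n%:R :> R by rewrite -natrM ler_nat.
    by have := ler_wpM2l M0 h'; lra.
  rewrite /term big_nat big1 => [|i /andP[_ iN]]; last by rewrite (negbTE (h i iN)) mulr0 mul0r.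
  by lra.
have /andP[b1 b2] : k%:R * n%:R <= norming (n%:R : R) <= (k%:R + 2) * n%:R.
  by apply: norming_window; rewrite ler_nat kn ltr_nat.
have b0 : 0 < norming (n%:R : R) by exact: norming_gt0.
have nnM : n%:R <= n%:R * M by rewrite ler_peMr// ltW.
have wn : n%:R * w <= n%:R * M by rewrite ler_wpM2l// ltW.
have wn0 : 0 <= n%:R * w by rewrite mulr_ge0// ltW.
have cwn : c%:R * (n%:R * w) <= c%:R * n%:R * M by rewrite -mulrA ler_wpM2l.
have cwn0 : 0 <= c%:R * (n%:R * w) by rewrite mulr_ge0.
have bw1 := ler_wpM2r w0 b1; have bw2 := ler_wpM2r w0 b2.
move: s1 s2 s3 s4; move: (\sum_(0 <= j < c) term j) (\sum_(c <= j < k) term j) (term k) (term k.+1).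
move=> S1 S2 S3 S4 /andP[s1 s1'] /andP[s2 s2'] /andP[s3 s3'] /andP[s4 s4'].
set S := n%:R + _.
(* All errors are of order [c * n * M]; since [norming n >= k * n >= c ^ 2 * n], the division leaves
   [M / c]. *)
have SE : `|S - norming n%:R * w| <= 10 * (c%:R * n%:R * M).
  by rewrite ler_distl /S; apply/andP; split; lra.
have -> : (norming n%:R)^-1 * S - w = (S - norming n%:R * w) / norming n%:R.
  by rewrite mulrBl [norming _ * w]mulrC mulfK ?gt_eqF// mulrC.
rewrite normrM normfV (gtr0_norm b0) ler_pdivrMr//; apply: le_trans SE _.
have c0R : (0 : R) < c%:R by rewrite ltr0n.
rewrite [leRHS]mulrAC ler_pdivlMr//.
apply: (@le_trans _ _ (10 * M * (k%:R * n%:R))); last first.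
  by apply: ler_wpM2l => //; rewrite mulr_ge0.
have c2 : c%:R * c%:R <= k%:R :> R by rewrite -natrM ler_nat mulnn.
have := ler_wpM2r nM c2.
by lra.
Qed.

End towers.

(** * Comparison of the normed sums with the renewal values *)

Section assembly.
Context d (X : measurableType d) (R : realType) (P : probability X R) (T : X -> X).
Hypothesis T_mp : measure_preserving P T.
Context d' (X' : measurableType d') (P' : probability X' R) (Y : X' -> R).
Hypotheses (mY : measurable_fun [set: X'] Y) (Y_ge0 : forall w, 0 <= Y w).
Local Notation pr := (prob P).
Local Notation expect := (mean P).

(* The value of the density at level j is the renewal value of index [stage j]. *)
Definition stage (j : nat) : nat := trunc_log 2 (trunc_log 2 j).

(* Chosen so that V_l is still constant along the orbits considered when the
   current stage is l + 1. *)
Definition persistence (l : nat) : nat := scale (2 ^ (2 ^ l.+2)).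

(** An orbit of length at most [scale (j ^ 4)] meets [r j = 0] with probability at most [2^-j]. The
    fourth power is there because, up to time [scale k.+1], the countdowns are needed down to a
    level [c] with [k < c ^ 4]. *)
Definition sparsity (j : nat) : R := 2^-1 ^+ j / (scale (j ^ 4))%:R.

Variables (V r : nat -> X -> nat).
Hypothesis HV : forall i, [/\ measurable_fun [set: X] (V i), (forall x, (V i x < ncodes i)%N),
      (forall k v, (k <= i)%N -> (v < ncodes i)%N ->
        `|pr (zeros V k i `&` [set x | V i x = v]) - pr (zeros V k i) * law P' Y i v| <= tol R i) &
      pr (moves T (persistence i) (V i)) <= tol R i].
Hypotheses (mr : forall j, measurable_fun [set: X] (r j))
  (rT : forall j x, (0 < r j x)%N -> r j (T x) = (r j x).-1)
  (r0 : forall j, pr [set x | r j x = 0%N] <= sparsity j).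

Let mV i : measurable_fun [set: X] (V i). Proof. by have [] := HV i. Qed.

Definition level_value (j : nat) (x : X) : R := renewal_value R V (stage j) x.

Definition normed_sum (n : nat) (x : X) : R :=
  (norming n%:R)^-1 * \sum_(0 <= i < n) density r level_value (iter i T x).

Lemma leq_stage i j : (i <= j)%N -> (stage i <= stage j)%N.
Proof. by move=> ij; rewrite !leq_trunc_log. Qed.

Lemma stage_exp q : stage (2 ^ (2 ^ q)) = q.
Proof. by rewrite /stage !trunc_expnK. Qed.

Lemma stage_bounds k : (0 < stage k)%N -> (2 ^ (2 ^ stage k) <= k < 2 ^ (2 ^ (stage k).+1))%N.
Proof.
rewrite /stage; set t := trunc_log 2 k; move=> q0.
have t0 : (0 < t)%N by case: t q0.
have k0 : (0 < k)%N by rewrite lt0n; apply/eqP => k0; move: t0; rewrite /t k0 trunc_log0.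
have /andP[h1 h2] := trunc_log_bounds (ltnSn 1) t0.
have /andP[h3 h4] := trunc_log_bounds (ltnSn 1) k0.
apply/andP; split; first by apply: leq_trans h3; rewrite leq_exp2l.
by apply: leq_trans h4 _; rewrite leq_exp2l.
Qed.

Let mvisit j : measurable [set x | visit r j x].
Proof. exact: (measurable_nat1 (fun t => (0 < t)%N && (scale j %| t)%N) (mr j)). Qed.

Lemma pr_visit j : pr [set x | visit r j x] <= 2 / (scale j)%:R.
Proof.
have s0 := scale_gt0 j.
have s0R : (0 : R) < (scale j)%:R by rewrite ltr0n.
have m0 : measurable [set x | (r j x %% scale j)%N = 0%N].
  exact: (measurable_nat1 (fun t => (t %% scale j)%N = 0%N)).
apply: (@le_trans _ _ (pr [set x | (r j x %% scale j)%N = 0%N])).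
  by apply: le_pr => // x /= /andP[_ /eqP].
have := pr_countdown_mod T_mp (mr j) (rT (j := j)) (r0 j) s0.
rewrite ler_distl => /andP[_ h]; apply: le_trans h _.
have : sparsity j <= (scale j)%:R^-1.
  rewrite /sparsity ler_pdivrMr ?ltr0n ?scale_gt0//.
  apply: (@le_trans _ _ 1).
    by rewrite exprn_ile1// ?invr_ge0// invf_le1// ler1n.
  rewrite mulrC ler_pdivlMr// mul1r ler_nat leq_scale//.
  by case: j {s0 s0R m0} => // j; rewrite -{1}[j.+1]expn1 leq_pexp2l.
move: (sparsity j) ((scale j)%:R^-1) => a b; lra.
Qed.

Lemma pr_visits n j : pr (\bigcup_(i < n) iter i T @^-1` [set x | visit r j x]) <=
  n%:R * (2 / (scale j)%:R).
Proof.
have -> : n%:R * (2 / (scale j)%:R) = \sum_(0 <= i < n) (2 / (scale j)%:R : R).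
  by rewrite big_const_nat subn0 iter_addr_0 mulr_natl.
apply: pr_bigU_le => i _; first exact: (measurable_iter_preimage T_mp).
by rewrite (pr_iter T_mp)//; exact: pr_visit.
Qed.

Lemma pow2_le_inv m q : (0 < q)%N -> (q <= 2 ^ m)%N -> (2^-1 ^+ m : R) <= q%:R^-1.
Proof.
by move=> q0 qm; rewrite exprVn lef_pV2 ?posrE ?exprn_gt0 ?ltr0n// -natrX ler_nat.
Qed.

Lemma pr_moves_from q : pr (\bigcup_(l in [set l | (q <= l)%N]) moves T (persistence l) (V l))
  <= 2 * 2^-1 ^+ q.
Proof.
rewrite -[X in X * _]mul1r; apply: pr_bigcup_pow2 => //.
  by move=> i; exact: (measurable_moves T_mp).
move=> i _; have [_ _ _ h] := HV i; apply: le_trans h _.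
apply: le_trans (tol_le R i) _; rewrite mul1r exprS.
by rewrite ler_piMl ?exprn_ge0// invf_le1// ler1n.
Qed.

(** With [c = 2 ^ (2 ^ q.-1)] one has [c ^ 2 <= k < c ^ 4], so the levels from [c] to [k] have stage
    [q.-1] or [q]. Six bad events of probability of order [1 / q] are discarded: some [V l] is not
    constant along the orbit ([B1]), the two stages may carry different values ([B2], [B3]), a
    countdown runs out ([B4]), a level beyond [k.+1] is met ([B5]), level [k.+1] is met although [n]
    is small compared to its scale ([B6]). *)
Lemma window_good n k : (0 < stage k)%N -> (scale k <= n < scale k.+1)%N ->
  exists A, [/\ measurable A, pr (~` A) <= 20 / (stage k)%:R &
    forall x, A x -> `|normed_sum n x - renewal_value R V (stage k) x| <=
      10 * (horizon (stage k).+1)%:R / (2 ^ (2 ^ (stage k).-1))%:R].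
Proof.
set q := stage k; move=> q0 /andP[kn nk].
set c := (2 ^ (2 ^ q.-1))%N.
have /andP[qk kq] := stage_bounds q0; rewrite -/q in qk kq.
have c0 : (0 < c)%N by rewrite expn_gt0.
have cc : (c ^ 2 = 2 ^ (2 ^ q))%N by rewrite /c -expnM -expnSr prednK.
have cccc : (c ^ 4 = 2 ^ (2 ^ q.+1))%N by rewrite (expnM c 2 2) cc -expnM -expnSr.
have ck2 : (c ^ 2 <= k)%N by rewrite cc.
have ck : (c <= k)%N by apply: leq_trans ck2; rewrite -mulnn leq_pmulr.
have q2 : (q <= 2 ^ q.-1)%N by rewrite -{1}(prednK q0) ltn_expl.
have qc : (q <= c)%N by apply: leq_trans q2 (ltnW (ltn_expl _ _)).
have qR : (0 : R) < q%:R by rewrite ltr0n.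
pose B1 := \bigcup_(l in [set l | (q.-1 <= l)%N]) moves T (persistence l) (V l).
pose B2 := [set x | V q.-1 x <> 0%N].
pose B3 := zeros V q (horizon q.-1).
pose F4 j := [set x | (r j x < n)%N].
pose B4 := \bigcup_(j in [set j | (c <= j)%N]) F4 j.
pose F5 j := \bigcup_(i < n) iter i T @^-1` [set x | visit r j x].
pose B5 := \bigcup_(j in [set j | (k.+2 <= j)%N]) F5 j.
(* Meeting level [k.+1] is harmful only if [c * n < scale k.+1], and then its probability is at most
   [2 / c]. *)
pose B6 := if (scale k.+1 <= c * n)%N then set0 else F5 k.+1.
have mF4 j : measurable (F4 j) by exact: (measurable_nat1 (fun t => (t < n)%N)).
have mF5 j : measurable (F5 j).
  by apply: bigcup_measurable => i _; exact: (measurable_iter_preimage T_mp).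
have mB1 : measurable B1 by apply: bigcup_measurable => i _; exact: (measurable_moves T_mp).
have mB2 : measurable B2 by exact: (measurable_nat1 (fun t => t <> 0%N)).
have mB3 : measurable B3 by exact: measurable_zeros.
have mB4 : measurable B4 by exact: bigcup_measurable.
have mB5 : measurable B5 by exact: bigcup_measurable.
have mB6 : measurable B6 by rewrite /B6; case: ifP.
have p1 : pr B1 <= 2 / q%:R.
  apply: le_trans (pr_moves_from q.-1) _; rewrite ler_wpM2l//; exact: pow2_le_inv.
have p2 : pr B2 <= 2 / q%:R.
  apply: le_trans (pr_nonzero HV q.-1) _; rewrite prednK//.
  have : tol R q.-1 <= q%:R^-1.
    apply: le_trans (tol_le R q.-1) _; rewrite prednK//; apply: pow2_le_inv => //.
    exact: ltnW (ltn_expl _ _).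
  by move: (q%:R^-1) (tol R _) => a b; lra.
have p3 : pr B3 <= q%:R^-1.
  have qh : (q <= horizon q.-1)%N by rewrite /horizon prednK// -mulnn; clear; lia.
  have := pr_zeros_le HV qh; rewrite -/B3 /horizon prednK// natr1 natrX expr2.
  have q1 : (0 : R) < q.+1%:R by rewrite ltr0n.
  rewrite -[leRHS]mulr1 -mulrA ler_pM2l// => h; rewrite -[leRHS]mul1r ler_pdivlMr//.
  apply: le_trans h; rewrite mulrC ler_wpM2r ?pr_ge0// ler_nat.
  exact: leqnSn.
have p4 : pr B4 <= 2 / q%:R.
  have h j : (c <= j)%N -> pr (F4 j) <= 1 * 2^-1 ^+ j.
    move=> cj; apply: le_trans (pr_countdown_lt T_mp (mr j) (rT (j := j)) (r0 j) n) _.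
    rewrite mul1r /sparsity mulrCA ler_piMr ?exprn_ge0// ler_pdivrMr ?ltr0n ?scale_gt0// mul1r ler_nat.
    apply: leq_trans (ltnW nk) _; apply: leq_scale; apply: leq_trans kq _.
    by rewrite -cccc leq_exp2r.
  apply: le_trans (pr_bigcup_pow2 _ mF4 h) _ => //; rewrite mul1r ler_wpM2l//.
  by apply: pow2_le_inv => //; apply: leq_trans qc (ltnW (ltn_expl _ _)).
have p5 : pr B5 <= 4 / q%:R.
  have h j : (k.+2 <= j)%N -> pr (F5 j) <= 2 * 2^-1 ^+ j.
    move=> kj; apply: le_trans (pr_visits n j) _.
    rewrite mulrCA ler_wpM2l// ler_pdivrMr ?ltr0n ?scale_gt0// exprVn mulrC.
    rewrite ler_pdivlMr ?exprn_gt0// -natrX -natrM ler_nat.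
    apply: leq_trans (leq_mul (ltnW nk) (leqnn _)) _.
    (* For [j >= k.+2] one has [k.+1 ^ 2 + j <= j ^ 2]. *)
    rewrite /scale -expnD leq_exp2l//.
    rewrite -(subnKC kj) -!mulnn; move: (j - k.+2)%N => m; clear; nia.
  apply: le_trans (pr_bigcup_pow2 _ mF5 h) _ => //.
  rewrite (_ : 2 * 2 = 4)//; last by ring.
  rewrite ler_wpM2l//; apply: pow2_le_inv => //.
  apply: leq_trans qc (leq_trans ck (leq_trans (ltnW (ltn_expl k (ltnSn 1))) _)).
  by rewrite leq_exp2l//; clear; lia.
have p6 : pr B6 <= 2 / q%:R.
  rewrite /B6; case: ifP => [_|/negbT]; first by rewrite pr_set0 divr_ge0.
  rewrite -ltnNge => h; apply: le_trans (pr_visits n k.+1) _.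
  rewrite mulrCA ler_wpM2l// ler_pdivrMr ?ltr0n ?scale_gt0// mulrC ler_pdivlMr//.
  rewrite -natrM ler_nat mulnC; apply: leq_trans (ltnW h).
  by rewrite leq_mul2r qc orbT.
exists (~` (B1 `|` B2 `|` B3 `|` B4 `|` B5 `|` B6)); split.
- by apply: measurableC; do 5 (apply: measurableU => //).
- rewrite setCK.
  have u1 := prU_le P mB1 mB2.
  have m12 := measurableU _ _ mB1 mB2.
  have u2 := prU_le P m12 mB3.
  have m123 := measurableU _ _ m12 mB3.
  have u3 := prU_le P m123 mB4.
  have m1234 := measurableU _ _ m123 mB4.
  have u4 := prU_le P m1234 mB5.
  have m12345 := measurableU _ _ m1234 mB5.
  have u5 := prU_le P m12345 mB6.
  have iq : 0 < (q%:R^-1 : R) by rewrite invr_gt0.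
  move: iq p1 p2 p3 p4 p5 p6 u1 u2 u3 u4 u5.
  move: (q%:R^-1) => a *; lra.
move=> x; rewrite !setCU => -[[[[[n1 n2] n3] n4] n5] n6].
have V0 : V q.-1 x = 0%N by apply: contrapT.
have stay i l : (i < n)%N -> (q.-1 <= l)%N -> V l (iter i T x) = V l x.
  move=> iN ql; apply: contrapT => Vl; apply: n1; exists l => //; exists i => //.
  apply: leq_trans (ltnW iN) (leq_trans (ltnW nk) _).
  apply: leq_scale; apply: leq_trans kq _; rewrite leq_exp2l// leq_exp2l//.
  by rewrite -ltnS -(prednK q0) !ltnS.
apply: (@birkhoff_density _ _ _ _ _ _ _ _ n k) => //.
- by move=> j y; have /andP[] := renewal_value_bound HV (stage j) y.
- by rewrite kn nk.
- by rewrite ler1n /horizon expn_gt0.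
- have /andP[w0 wq] := renewal_value_bound HV q x; rewrite w0 (le_trans wq)// ler_nat.
  by rewrite leq_exp2r.
- move=> i j jk; have /andP[_ h] := renewal_value_bound HV (stage j) (iter i T x).
  apply: le_trans h _; rewrite ler_nat leq_exp2r// !ltnS.
  rewrite -[q.+1]stage_exp; apply: leq_stage; exact: leq_trans jk kq.
- move=> i j iN kj; apply/negP => vij; apply: n5; exists j => //.
  by exists i.
- move: n6; rewrite /B6; case: ifP => [h _|_ h]; first by left.
  by right => i iN; apply/negP => vi; apply: h; exists i.
- move=> j /andP[cj _]; rewrite leqNgt; apply/negP => rj; apply: n4.
  by exists j.
- move=> i j iN /andP[cj jk].
  have [e1 e2] := renewal_value_stable R q0 V0 n3 (fun l lh => stay i l iN (proj1 (andP lh))).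
  have h1 : (stage j <= q)%N by exact: leq_stage.
  have h2 : (q.-1 <= stage j)%N by rewrite -[q.-1]stage_exp; exact: leq_stage.
  rewrite /level_value.
  have [->//|jq] := eqVneq (stage j) q.
  rewrite (_ : stage j = q.-1)//; apply/eqP; rewrite eqn_leq h2 andbT.
  by rewrite -ltnS prednK// ltn_neqAle jq.
Qed.

(** A double exponential beats a cubic polynomial; with this the error in [window_good] is at most
    [180 / q]. *)
Lemma horizon_le q : (3 <= q)%N -> (horizon q.+1 * q <= 18 * 2 ^ (2 ^ q.-1))%N.
Proof.
move=> q3; have [m ->] : exists m, q = m.+3 by exists (q - 3)%N; lia.
rewrite /horizon /=.
have h1 : (m.+2 <= 2 ^ m.+1)%N by exact: ltn_expl.
have h2 : (2 ^ m.+1 <= 2 ^ (2 ^ m))%N by rewrite leq_exp2l// ltn_expl.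
have h3 : (m.+2 ^ 4 <= 2 ^ (2 ^ m.+2))%N.
  rewrite (_ : 2 ^ m.+2 = 2 ^ m * 4)%N; last by rewrite -(addn2 m) expnD.
  by rewrite expnM leq_exp2r// (leq_trans h1).
have h4 : (m.+2 ^ 3 <= 2 ^ (2 ^ m.+2))%N by apply: leq_trans h3; rewrite leq_pexp2l.
apply: leq_trans (leq_mul (leqnn 18) h4).
rewrite !expnS !expn0; clear; nia.
Qed.

(** The stage grows with [n], so the variable compared with the normed sum changes with [n]. This
    does no harm, because the law and the near invariance of [renewal_value q] are controlled
    uniformly for large [q]. *)
Lemma normed_sum_close (e : R) (q0 : nat) : 0 < e -> exists N, forall n, (N <= n)%N ->
  exists q A, [/\ (q0 <= q)%N, measurable A, pr (~` A) <= e &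
    forall x, A x -> `|normed_sum n x - renewal_value R V q x| <= e].
Proof.
move=> e0.
pose q1 := maxn (maxn q0 3) (Num.truncn (180 / e)).+1.
exists (scale (2 ^ (2 ^ q1))) => n nN.
have n1 : (1 : R) <= n%:R by rewrite ler1n (leq_trans (scale_gt0 _) nN).
have [k] := window n1; rewrite ler_nat ltr_nat => kn.
have /andP[kn1 kn2] := kn.
have qk : (2 ^ (2 ^ q1) <= k)%N.
  rewrite leqNgt; apply/negP => h; have := leq_trans kn2 (leq_scale h).
  by rewrite ltnNge nN.
have q1s : (q1 <= stage k)%N by rewrite -[q1]stage_exp; exact: leq_stage.
have : (maxn q0 3 <= stage k)%N by apply: leq_trans q1s; rewrite leq_maxl.
rewrite geq_max => /andP[s0 s3].
have sR : (0 : R) < (stage k)%:R by rewrite ltr0n (leq_trans _ s3).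
have se : 180 / (stage k)%:R <= e.
  rewrite ler_pdivrMr// mulrC -ler_pdivrMr//; apply: le_trans (ltW (truncnS_gt _)) _.
  by rewrite ler_nat; apply: leq_trans q1s; rewrite leq_maxr.
have [A [mA pA hA]] := window_good (leq_trans (isT : (0 < 3)%N) s3) kn.
exists (stage k), A; split => //.
  apply: le_trans pA (le_trans _ se); rewrite ler_wpM2r ?invr_ge0 ?ler0n//.
  by rewrite ler_nat.
move=> x Ax; apply: le_trans (hA x Ax) (le_trans _ se).
rewrite ler_pdivlMr// mulrAC ler_pdivrMr ?ltr0n ?expn_gt0//.
rewrite -!mulrA -natrM (_ : 180 = 10 * 18); last by rewrite -natrM.
rewrite -mulrA ler_wpM2l// -natrM ler_nat.
exact: horizon_le.
Qed.

Lemma measurable_normed_sum n : measurable_fun [set: X] (normed_sum n).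
Proof.
apply: measurable_funM => //; apply: measurable_sum => i.
apply: measurableT_comp (measurable_iter T_mp i).
apply: measurable_density => [j y|//|j]; first by have /andP[] := renewal_value_bound HV (stage j) y.
exact: (measurable_renewed HV).
Qed.

Hypothesis T_erg : ergodic P T.

(** * Weighted means of bounded, uniformly continuous functions of the normed sums *)

Section test_functions.
Variables (g : R -> R) (C : R).
Hypotheses (mg : measurable_fun [set: R] g) (gC : forall z, `|g z| <= C).
Hypothesis g_unif : forall e : R, 0 < e ->
  exists2 del : R, 0 < del & forall y z : R, `|y - z| < del -> `|g y - g z| <= e.

Let C0 : 0 <= C. Proof. exact: le_trans (normr_ge0 _) (gC 0). Qed.

(** Three replacements, each at a cost of [e / 4]: the normed sum by a renewal value, the weighted
    mean by a product of means since renewal values are almost invariant, and the mean at the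
    renewal value by the mean at [Y]. The weight [h] will be a density. *)
Lemma weighted_limit (h : X -> R) (e : R) : measurable_fun [set: X] h ->
  (forall x, 0 <= h x <= 1) -> 0 < e -> exists N, forall n, (N <= n)%N ->
  `|expect (fun x => g (normed_sum n x) * h x) - mean P' (fun w => g (Y w)) * expect h| <= e.
Proof.
move=> mh h01 e0; have bh := bdd_meas01 mh h01.
(* [C] may be 0, and the tolerances are divided by this constant. *)
pose C1 := C + 1.
have C10 : 0 < C1 by have := C0; rewrite /C1; lra.
have e3 : 0 < e / 4 / C1 by rewrite !divr_gt0.
have e4 : 0 < e / 4 by rewrite divr_gt0.
have e8 : 0 < e / 8 by rewrite divr_gt0.
have [rho rho0 Hrho] := almost_invariant_decouple T_mp T_erg mh h01 e3.
have [q1 Hq1] := renewal_value_law mY Y_ge0 HV mg gC g_unif e4.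
have [del del0 gdel] := g_unif e8.
pose del' := Num.min (del / 2) (e / 16 / C1).
have del'0 : 0 < del' by rewrite lt_min !divr_gt0.
(* The [u] defined below has displacement at most 2 and moves with probability at most [2 / q],
   whence the 4. *)
pose q2 := (Num.truncn (4 / rho)).+1.
have [N HN] := normed_sum_close (maxn q1 q2) del'0.
exists N => n /HN[q [A [+ mA pA hA]]]; rewrite geq_max => /andP[q1q q2q].
have bF : bdd_meas (fun x => g (normed_sum n x)).
  by split; [exact: measurableT_comp (measurable_normed_sum n)|exists C].
have bW : bdd_meas (fun x => g (renewal_value R V q x)).
  by split; [exact: measurableT_comp (measurable_renewed HV _ _ _)|exists C].
have /andP[Eh0 Eh1] : 0 <= expect h <= 1.
  rewrite expect_ge0 => [|x]; last by have /andP[] := h01 x.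
  rewrite -[leRHS](expect_cst P 1); apply: le_expect => // [|x]; first exact: bdd_meas_cst.
  by have /andP[] := h01 x.
have S1 : `|expect (fun x => g (normed_sum n x) * h x) - expect (fun x => g (renewal_value R V q x) * h x)| <= e / 4.
  have bD := bdd_measB bF bW.
  rewrite -expectB; [|exact: bdd_measM..].
  rewrite (_ : (fun x => _) = (fun x => h x * (g (normed_sum n x) - g (renewal_value R V q x)))); last first.
    by apply/funext => x; ring.
  apply: le_trans (norm_expectM_le P (C := 1) bh bD _) _.
    by move=> x; have /andP[q0 h1] := h01 x; rewrite ger0_norm.
  rewrite mul1r; apply: le_trans (expect_le_good P (A := A) (e := e / 8) (C := 2 * C1) _ _ _ _ _ _) _.
  - exact: ltW.
  - by rewrite mulr_ge0// ltW.
  - exact: bdd_meas_norm.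
  - exact: mA.
  - move=> x Ax; apply: gdel; apply: le_lt_trans (hA x Ax) _.
    have : del' <= del / 2 by rewrite /del' ge_min lexx.
    by lra.
  - move=> x; apply: le_trans (ler_normB _ _) _.
    by have := gC (normed_sum n x); have := gC (renewal_value R V q x); rewrite /C1; lra.
  - have : del' <= e / 16 / C1 by rewrite /del' ge_min lexx orbT.
    move/(le_trans pA); rewrite ler_pdivlMr//; lra.
have S2 : `|expect (fun x => g (renewal_value R V q x) * h x) - expect (fun x => g (renewal_value R V q x)) * expect h| <= e / 4.
  pose u x := C1^-1 * g (renewal_value R V q x).
  have bu : bdd_meas u by exact: bdd_measZ.
  have u1 x : `|u x| <= 1.
    rewrite /u normrM gtr0_norm ?invr_gt0// mulrC ler_pdivrMr// mul1r.
    by apply: le_trans (gC _) _; rewrite /C1 lerDl.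
  have [mT _] := T_mp.
  pose B := \bigcup_(l in [set l | (q <= l)%N]) moves T (persistence l) (V l).
  have mB : measurable B by apply: bigcup_measurable => l _; exact: (measurable_moves T_mp).
  have urho : expect (fun x => `|u (T x) - u x|) <= rho.
    apply: (@le_trans _ _ (0 + 2 * pr (~` (~` B)))).
      apply: expect_le_good => //.
      + by apply/bdd_meas_norm/bdd_measB => //; exact: bdd_meas_comp.
      + exact: measurableC.
      + move=> x nB; rewrite /u /renewal_value (renewed_ext _ (x := x) (y := T x)) ?subrr ?normr0//.
        move=> l /andP[ql _]; apply: contrapT => Vl; apply: nB; exists l => //.
        by exists 1%N => //; exact: scale_gt0.
      + move=> x; apply: le_trans (ler_normB _ _) _.
        by have := u1 x; have := u1 (T x); lra.
    rewrite add0r setCK; apply: le_trans (ler_wpM2l _ (pr_moves_from q)) _ => //.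
    have q0 : (0 < q)%N by exact: leq_trans q2q.
    have : (2^-1 ^+ q : R) <= q%:R^-1 by apply: pow2_le_inv => //; exact: ltnW (ltn_expl _ _).
    have : 4 / q%:R <= rho.
      rewrite ler_pdivrMr ?ltr0n// mulrC -ler_pdivrMr//; apply: le_trans (ltW (truncnS_gt _)) _.
      by rewrite ler_nat.
    by move: (q%:R^-1) => a; lra.
  have := Hrho u bu u1 urho.
  rewrite (_ : (fun x => u x * h x) = (fun x => C1^-1 * (g (renewal_value R V q x) * h x))); last first.
    by apply/funext => x; rewrite /u mulrA.
  rewrite expectZ; last exact: bdd_measM.
  rewrite /u expectZ// -mulrA -mulrBr normrM gtr0_norm ?invr_gt0//.
  by rewrite mulrC ler_pM2r ?invr_gt0.
have S3 : `|expect (fun x => g (renewal_value R V q x)) * expect h - mean P' (fun w => g (Y w)) * expect h| <= e / 4.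
  rewrite -mulrBl normrM (ger0_norm Eh0); apply: le_trans (Hq1 q q1q).
  by rewrite ler_piMr.
apply: le_trans (ler_distD (expect (fun x => g (renewal_value R V q x) * h x)) _ _) _.
apply: le_trans (lerD S1 (le_trans (ler_distD (expect (fun x => g (renewal_value R V q x)) * expect h) _ _) (lerD S2 S3))) _.
by lra.
Qed.

End test_functions.
End assembly.

(** * Strong convergence *)

(* On A, the density of Q with respect to P is bounded by K, and q is this density
   divided by K. *)
Lemma density_split d (X : measurableType d) (R : realType) (P Q : probability X R) (e : R) :
  Q `<< P -> 0 < e -> exists A K (q : X -> R), [/\ measurable A, 0 < K,
    measurable_fun [set: X] q /\ (forall x, 0 <= q x <= 1),
    prob Q (~` A) <= e &
    forall h, bdd_meas h -> (forall x, 0 <= h x) ->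
      mean Q (fun x => \1_A x * h x) = K * mean P (fun x => h x * q x)].
Proof.
move=> QP e0.
pose F := Radon_Nikodym_SigmaFinite.f Q P.
have F0 x : (0 <= F x)%E by exact: Radon_Nikodym_SigmaFinite.f_ge0.
have Ffin x : F x \is a fin_num by exact: Radon_Nikodym_SigmaFinite.f_fin_num.
have mF : measurable_fun [set: X] F.
  exact: measurable_int (Radon_Nikodym_SigmaFinite.f_integrable QP).
pose rho x := fine (F x).
have FE x : F x = (rho x)%:E by rewrite /rho fineK.
have rho0 x : 0 <= rho x by exact: fine_ge0.
have mrho : measurable_fun [set: X] rho by exact: measurableT_comp.
pose B m := [set x | m%:R <= rho x].
have mB m : measurable (B m) by exact: measurable_ge.
have dB m : B m.+1 `<=` B m by move=> x /=; apply: le_trans; rewrite ler_nat.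
have B0 : \bigcap_m B m = set0.
  apply/seteqP; split => x // /(_ (Num.truncn (rho x)).+1 I) /= h.
  by have := lt_le_trans (truncnS_gt (rho x)) h; rewrite ltxx.
have [m] := pr_bigcap_approx Q e0 mB dB.
rewrite B0 pr_set0 add0r => Bm.
have mA : measurable (~` B m) by exact: measurableC.
have K0 : (0 : R) < m.+1%:R by rewrite ltr0n.
pose q x : R := m.+1%:R^-1 * (\1_(~` B m) x * rho x).
exists (~` B m), m.+1%:R, q; split => //; last 2 first.
- by rewrite setCK ltW.
- move=> h bh h0; have [mh _] := bh.
  have mI : measurable_fun [set: X] (\1_(~` B m) : X -> R).
    exact: (proj1 (bdd_meas_indic R mA)).
  have bq : bdd_meas q.
    split; first by do 2 (apply: measurable_funM => //).
    exists 1 => x; rewrite /q indicE; case: (boolP (x \in _)) => [/set_mem /= /negP|_].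
      rewrite -ltNge => xm; rewrite mul1r ger0_norm ?mulr_ge0//.
      rewrite mulrC ler_pdivrMr// mul1r; apply: ltW (lt_trans xm _).
      by rewrite ltr_nat.
    by rewrite mul0r mulr0 normr0.
  rewrite -expectZ; last exact: bdd_measM.
  rewrite /mean /Rintegral; congr fine.
  rewrite -(Radon_Nikodym_SigmaFinite.change_of_variables QP)//.
  + apply: eq_integral => x _; rewrite -/F FE -EFinM; congr EFin.
    by rewrite /q; field; rewrite gt_eqF.
  + by move=> x; rewrite lee_fin mulr_ge0// indicE.
  + by apply/measurable_EFinP; exact: measurable_funM.
- split; first by do 2 (apply: measurable_funM => //); exact: (proj1 (bdd_meas_indic R mA)).
  move=> x; rewrite /q indicE; case: (boolP (x \in _)) => [/set_mem /= /negP|_].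
    rewrite -ltNge => xm; rewrite mul1r mulr_ge0//=.
    rewrite mulrC ler_pdivrMr// mul1r; apply: ltW (lt_trans xm _).
    by rewrite ltr_nat.
  by rewrite mul0r mulr0 lexx ler01.
Qed.

(** * Clamping, and uniform continuity around a segment *)

Section real_functions.
Context (R : realType).
Implicit Types (g : R -> R) (a b x y z : R).

Definition clamp a b x := Num.max a (Num.min x b).

Lemma clamp_bounds a b x : a <= b -> a <= clamp a b x <= b.
Proof. by move=> ab; rewrite /clamp le_max lexx/= ge_max ab ge_min lexx orbT. Qed.

Lemma clamp_id a b x : a <= x <= b -> clamp a b x = x.
Proof.
by move=> /andP[ax xb]; rewrite /clamp (min_idPl xb); exact/max_idPr.
Qed.

Lemma clamp_lipschitz a b x y : `|clamp a b x - clamp a b y| <= `|x - y|.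
Proof.
wlog xy : x y / x <= y => [H|].
  by have [xy|/ltW yx] := leP x y; [exact: H|rewrite distrC [leRHS]distrC; exact: H].
have c : clamp a b x <= clamp a b y.
  by rewrite /clamp; apply: le_max2 => //; exact: le_min2.
rewrite !ler0_norm ?subr_le0// !opprB.
rewrite /clamp; have [yb|yb] := leP y b; have [xb|xb] := leP x b => //=.
- by have [?|?] := leP a x; have [?|?] := leP a y; lra.
- by have [?|?] := leP a b; have [?|?] := leP a y; lra.
- by have [?|?] := leP a x; have [?|?] := leP a b; lra.
- by have [?|?] := leP a b; lra.
Qed.

(** [g] is continuous on the line at each point of the segment, so only [y] has to lie in it.
    Compactness is used as a near-covering property, for the filter of radii tending to 0 from the
    right. *)
Lemma segment_unif_continuous g a b :
  (forall x, a <= x <= b -> {for x, continuous g}) -> forall e : R, 0 < e ->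
  exists2 del : R, 0 < del & forall y z, a <= y <= b -> `|y - z| < del -> `|g y - g z| <= e.
Proof.
move=> cg e e0.
have e2 : 0 < e / 2 by rewrite divr_gt0.
have cK : compact `[a, b] := @segment_compact R a b.
have /compact_near_coveringP/(_ R (0^'+)%R
  (fun del y => forall z, `|y - z| < del -> `|g y - g z| <= e) _) := cK.
case=> [x|r /= r0 H].
- rewrite /= in_itv/= => xab; have /cvgrPdist_lt/(_ _ e2) := cg x xab.
  move=> [r /= r0 Hr].
  exists ([set y | `|x - y| < r / 2], [set del | del < r / 2]).
    split; first by exists (r / 2); rewrite /= ?divr_gt0.
    exists (r / 2); rewrite /= ?divr_gt0// => del /= + _.
    by rewrite sub0r normrN => /(le_lt_trans (ler_norm _)).
  move=> [y del] [/= xy dr] z yz.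
  have h1 : `|g x - g y| < e / 2 by apply: Hr; rewrite /= (lt_trans xy)//; lra.
  have h2 : `|g x - g z| < e / 2.
    apply: Hr => /=; apply: le_lt_trans (ler_distD y _ _) _.
    by have := lt_trans yz dr; lra.
  apply: le_trans (ler_distD (g x) _ _) _; rewrite distrC; lra.
exists (r / 2); first by rewrite divr_gt0.
move=> y z yab; apply: (H (r / 2)) => /=.
- by rewrite sub0r normrN gtr0_norm ?divr_gt0//; lra.
- by rewrite divr_gt0.
- by rewrite in_itv.
Qed.

Lemma unif_continuous_measurable g : (forall e : R, 0 < e ->
    exists2 del : R, 0 < del & forall y z, `|y - z| < del -> `|g y - g z| <= e) ->
  measurable_fun [set: R] g.
Proof.
move=> ug; apply: continuous_measurable_fun => x.
apply/cvgrPdist_le => e /ug[del del0 H].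
by exists del => //= y /H.
Qed.

End real_functions.

(** * From weighted means under P to continuous test functions under Q *)

Section strong_limit.
Context d (X : measurableType d) (R : realType) (P Q : probability X R).
Context d' (X' : measurableType d') (P' : probability X' R) (Y : X' -> R).
Hypotheses (mY : measurable_fun [set: X'] Y) (Y_gt0 : forall w, 0 < Y w).
Hypothesis QP : Q `<< P.
Variable F : nat -> X -> R.
Hypothesis mF : forall n, measurable_fun [set: X] (F n).
Hypothesis F_weighted : forall (g : R -> R) (C : R),
  measurable_fun [set: R] g -> (forall z, `|g z| <= C) ->
  (forall e : R, 0 < e ->
    exists2 del : R, 0 < del & forall y z, `|y - z| < del -> `|g y - g z| <= e) ->
  forall (h : X -> R) (e : R), measurable_fun [set: X] h ->
  (forall x, 0 <= h x <= 1) -> 0 < e -> exists N, forall n, (N <= n)%N ->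
  `|mean P (fun x => g (F n x) * h x) - mean P' (fun w => g (Y w)) * mean P h| <= e.

(** On [A], the measure [Q] is [K] times a weight between 0 and 1 against [P], so the assumption on
    weighted means applies; off [A], the bound [2 C] meets a small probability. *)
Lemma unif_limit (g : R -> R) (C e : R) : (forall z, `|g z| <= C) ->
  (forall e : R, 0 < e ->
    exists2 del : R, 0 < del & forall y z, `|y - z| < del -> `|g y - g z| <= e) ->
  0 < e -> exists N, forall n, (N <= n)%N ->
  `|mean Q (fun x => g (F n x)) - mean P' (fun w => g (Y w))| <= e.
Proof.
move=> gC ug e0; have mg := unif_continuous_measurable ug.
have C0 : 0 <= C by exact: le_trans (normr_ge0 _) (gC 0).
pose C1 := C + 1.
have C10 : 0 < C1 by rewrite /C1; lra.
have e1 : 0 < e / 4 / C1 by rewrite !divr_gt0.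
have [A [K [q [mA K0 [mq q01] QA HA]]]] := density_split QP e1.
have bq := bdd_meas01 mq q01.
have e2 : 0 < e / 4 / K by rewrite !divr_gt0.
have [N HN] := F_weighted mg gC ug mq q01 e2.
exists N => n /HN {}HN.
set c := mean P' _ in HN *.
have bgY : bdd_meas (fun w => g (Y w)) by split; [exact: measurableT_comp|exists C].
have cC : `|c| <= C.
  apply: le_trans (le_norm_expect P' bgY) _; rewrite -[leRHS](expect_cst P').
  by apply: le_expect => //; [exact: bdd_meas_norm|exact: bdd_meas_cst].
pose u x := g (F n x).
have bu : bdd_meas u.
  by split; [exact: (measurableT_comp mg (mF n))|exists C => x; exact: gC].
have bc := bdd_meas_cst X.
have bI := bdd_meas_indic R mA.
have uc : bdd_meas (fun x => u x - c) by exact: bdd_measB.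
(* The change of measure is stated for nonnegative functions, so [u - c] is written as the
   difference of [u + C] and [C + c]. *)
have E1 : mean Q (fun x => \1_A x * (u x - c)) = K * (mean P (fun x => u x * q x) - c * mean P q).
  have := HA (fun x => u x + C) (bdd_measD bu (bc R C)).
  have := HA (fun=> C + c) (bc R _).
  have -> : (fun x => \1_A x * (u x - c)) = (fun x => \1_A x * (u x + C) - \1_A x * (C + c)).
    by apply/funext => x; ring.
  rewrite expectB; [|by apply: bdd_measM => //; exact: bdd_measD|exact: bdd_measM].
  move=> -> => [|_]; last by have := ler_norm (- c); rewrite normrN; lra.
  move=> -> => [|x]; last by have := ler_norm (- u x); rewrite normrN; have := gC (F n x); rewrite -/(u x); lra.
  rewrite (_ : (fun x => (u x + C) * q x) = (fun x => u x * q x + C * q x)); last first.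
    by apply/funext => x; ring.
  by rewrite expectD ?expectZ//; [ring|exact: bdd_measM|exact: bdd_measZ].
have uc2 x : `|u x - c| <= 2 * C.
  by apply: le_trans (ler_normB _ _) _; have := gC (F n x); rewrite -/(u x); lra.
have -> : mean Q (fun x => g (F n x)) - c =
    mean Q (fun x => \1_A x * (u x - c)) + mean Q (fun x => \1_(~` A) x * (u x - c)).
  rewrite -expectD; [|exact: bdd_measM|apply: bdd_measM => //; exact/bdd_meas_indic/measurableC].
  rewrite -[X in _ - X](expect_cst Q) -expectB//.
  congr (mean Q _); apply/funext => x; rewrite -mulrDl indicE indicE in_setC.
  by case: (_ \in _) => /=; rewrite ?addr0 ?add0r mul1r.
have E2 : `|mean Q (fun x => \1_(~` A) x * (u x - c))| <= 2 * C * (e / 4 / C1).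
  rewrite (_ : (fun x => _) = (fun x => (u x - c) * \1_(~` A) x)); last first.
    by apply/funext => x; rewrite mulrC.
  apply: le_trans (norm_expectM_le Q uc _ uc2) _; first exact/bdd_meas_indic/measurableC.
  rewrite ler_wpM2l ?mulr_ge0//.
  under eq_fun do rewrite ger0_norm ?indicE//.
  by rewrite -/(\1_(~` A)) (expect_indic Q (measurableC mA)).
have E3 : 2 * C * (e / 4 / C1) <= e / 2.
  rewrite mulrA ler_pdivrMr// /C1; nra.
apply: le_trans (ler_normD _ _) _; rewrite E1 normrM gtr0_norm//.
have : K * `|mean P (fun x => u x * q x) - c * mean P q| <= e / 4.
  by rewrite mulrC -ler_pdivlMr.
by lra.
Qed.

(** Tightness in the open half-line comes from the convergence itself: the cut-off [chi], equal to 1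
    on [[a, b]] and to 0 off a slightly larger segment, is a uniformly continuous test function, so
    its mean at [F n] is nearly as close to 1 as at [Y]. On the larger segment [g] coincides with
    [g1], which is uniformly continuous on the whole line. *)
Lemma strong_limit (g : R -> R) (C e : R) : measurable_fun [set: R] g ->
  (forall z, `|g z| <= C) -> (forall x, 0 < x -> {for x, continuous g}) ->
  0 < e -> exists N, forall n, (N <= n)%N ->
  `|mean Q (fun x => g (F n x)) - mean P' (fun w => g (Y w))| <= e.
Proof.
move=> mg gC cg e0.
have C0 : 0 <= C by exact: le_trans (normr_ge0 _) (gC 0).
pose C1 := C + 1.
have C10 : 0 < C1 by rewrite /C1; lra.
have e1 : 0 < e / 16 / C1 by rewrite !divr_gt0.
(* The events that [Y] is not in [[1 / (m+1), m+1[] decrease to the empty set because [Y] is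
   positive and finite. *)
pose B m := ~` ([set w | m.+1%:R^-1 <= Y w] `\` [set w | m.+1%:R <= Y w]).
have mB m : measurable (B m).
  by apply: measurableC; apply: measurableD; exact: measurable_ge.
have dB m : B m.+1 `<=` B m.
  move=> w nB h; apply: nB; move: h => [/= h1 /negP]; rewrite -ltNge => h2; split => /=.
    by apply: le_trans h1; rewrite lef_pV2 ?posrE ?ltr0n// ler_nat.
  by apply/negP; rewrite -ltNge; apply: lt_le_trans h2 _; rewrite ler_nat.
have B0 : \bigcap_m B m = set0.
  apply/seteqP; split => w // /(_ (Num.truncn (Y w) + Num.truncn ((Y w)^-1))%N I); apply; split => /=.
    rewrite invf_ple ?posrE ?ltr0n//; apply: le_trans (ltW (truncnS_gt _)) _.
    by rewrite ler_nat ltnS leq_addl.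
  apply/negP; rewrite -ltNge; apply: lt_le_trans (truncnS_gt _) _.
  by rewrite ler_nat ltnS leq_addr.
have [m] := pr_bigcap_approx P' e1 mB dB.
rewrite B0 pr_set0 add0r => Bm.
pose a : R := m.+1%:R^-1; pose b : R := m.+1%:R.
have a0 : 0 < a by rewrite invr_gt0 ltr0n.
have ab : a <= b.
  apply: (@le_trans _ _ 1); first by rewrite invf_le1 ?ltr0n// ler1n.
  by rewrite ler1n.
(* Half of [a], so that [[a - del, b + del]] stays in the half-line where [g] is continuous. *)
pose del := a / 2.
have del0 : 0 < del by rewrite divr_gt0.
pose chi x := Num.max 0 (1 - `|x - clamp a b x| / del).
pose g1 x := g (clamp (a - del) (b + del) x).
have chi0 x : 0 <= chi x by rewrite le_max lexx.
have chi1 x : chi x <= 1 by rewrite ge_max ler01 gerBl divr_ge0// ltW.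
have chiC x : `|chi x| <= 1 by rewrite ger0_norm.
have g1C x : `|g1 x| <= C by exact: gC.
have uchi e' : 0 < e' -> exists2 del' : R, 0 < del' &
    forall y z, `|y - z| < del' -> `|chi y - chi z| <= e'.
  move=> e'0; exists (e' * del / 2); first by rewrite divr_gt0// mulr_gt0.
  move=> y z yz; have cl := clamp_lipschitz a b y z.
  set s := `|y - clamp a b y| / del; set t := `|z - clamp a b z| / del.
  have st : `|s - t| <= e'.
    rewrite /s /t -mulrBl normrM normfV (gtr0_norm del0) ler_pdivrMr//.
    apply: le_trans (ler_dist_dist _ _) _.
    rewrite (_ : _ - _ = (y - z) - (clamp a b y - clamp a b z)); last by ring.
    by apply: le_trans (ler_normB _ _) _; lra.
  move: st; rewrite /chi -/s -/t !ler_distl => /andP[h1 h2].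
  have [h3|h3] := leP 0 (1 - s); have [h4|h4] := leP 0 (1 - t); apply/andP; split; lra.
have ug1 e' : 0 < e' -> exists2 del' : R, 0 < del' &
    forall y z, `|y - z| < del' -> `|g1 y - g1 z| <= e'.
  move=> e'0.
  have adb : a - del <= b + del by lra.
  have [|del' del'0 H] := @segment_unif_continuous R g (a - del) (b + del) _ e' e'0.
    by move=> x /andP[ax _]; apply: cg; apply: lt_le_trans ax; rewrite /del; lra.
  exists del' => // y z yz; apply: H; first exact: clamp_bounds.
  exact: le_lt_trans (clamp_lipschitz _ _ _ _) yz.
have gg1 x : `|g x - g1 x| <= 2 * C * (1 - chi x).
  have [xin|xout] := boolP (a - del <= x <= b + del).
    by rewrite /g1 clamp_id// subrr normr0 !mulr_ge0// subr_ge0.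
  have -> : chi x = 0.
    apply/max_idPl; rewrite subr_le0 ler_pdivlMr// mul1r.
    have := clamp_bounds x ab; move: xout; rewrite negb_and -!ltNge => /orP[h|h] /andP[h1 h2].
      by rewrite ler0_norm; lra.
    by rewrite ger0_norm; lra.
  by rewrite subr0 mulr1; apply: le_trans (ler_normB _ _) _; have := gC x; have := g1C x; lra.
have mchi := unif_continuous_measurable uchi.
have mg1 := unif_continuous_measurable ug1.
have e4 : 0 < e / 4 by rewrite divr_gt0.
have [N1 HN1] := unif_limit chiC uchi e1.
have [N2 HN2] := unif_limit g1C ug1 e4.
exists (maxn N1 N2) => n; rewrite geq_max => /andP[/HN1 {}HN1 /HN2 {}HN2].
have close d1 (X1 : measurableType d1) (Q1 : probability X1 R) (Z : X1 -> R) :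
    measurable_fun [set: X1] Z ->
    `|mean Q1 (fun x => g (Z x)) - mean Q1 (fun x => g1 (Z x))|
      <= 2 * C * (1 - mean Q1 (fun x => chi (Z x))).
  move=> mZ.
  have bg : bdd_meas (fun x => g (Z x)) by split; [exact: measurableT_comp|exists C].
  have bg1 : bdd_meas (fun x => g1 (Z x)) by split; [exact: measurableT_comp|exists C].
  have bchi : bdd_meas (fun x => chi (Z x)) by split; [exact: measurableT_comp|exists 1].
  have b1 : bdd_meas (fun x : X1 => 1 - chi (Z x)) by apply: bdd_measB => //; exact: bdd_meas_cst.
  rewrite -expectB//; apply: le_trans (le_norm_expect Q1 (bdd_measB bg bg1)) _.
  rewrite -[X in X - _](expect_cst Q1) -expectB//; last exact: bdd_meas_cst.
  rewrite -expectZ//; apply: le_expect => //; first by apply: bdd_meas_norm; exact: bdd_measB.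
  exact: bdd_measZ.
have chiY : 1 - mean P' (fun w => chi (Y w)) <= e / 16 / C1.
  have bchi : bdd_meas (fun w => chi (Y w)) by split; [exact: measurableT_comp|exists 1].
  rewrite -[X in X - _](expect_cst P') -expectB//; last exact: bdd_meas_cst.
  apply: le_trans (expect_le_good P' (A := ~` B m) (e := 0) (C := 1) _ _ _ _ _ _) _ => //.
  - by apply: bdd_measB => //; exact: bdd_meas_cst.
  - exact: measurableC.
  - move=> w; rewrite setCK => -[/= h1 /negP]; rewrite -ltNge => h2.
    by rewrite /chi clamp_id ?subrr ?normr0 ?mul0r ?subr0 ?(max_idPr ler01) ?subrr// h1 ltW.
  - by move=> w; rewrite gerBl.
  - by rewrite setCK add0r mul1r ltW.
have c1 := close _ _ Q (F n) (mF n).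
have c2 := close _ _ P' Y mY.
set u := mean Q (fun x => g (F n x)) in c1 *.
set u1 := mean Q (fun x => g1 (F n x)) in c1 HN2 *.
set v := mean P' (fun x => g (Y x)) in c2 *.
set v1 := mean P' (fun x => g1 (Y x)) in c2 HN2 *.
set cf := mean Q (fun x => chi (F n x)) in c1 HN1 *.
set cy := mean P' (fun x => chi (Y x)) in c2 HN1 chiY *.
have cf1 : 1 - cf <= 2 * (e / 16 / C1).
  by move: HN1; rewrite ler_distl => /andP[+ _]; lra.
have k1 : 2 * C * (1 - cf) <= 2 * C * (2 * (e / 16 / C1)) by rewrite ler_wpM2l// mulr_ge0.
have k2 : 2 * C * (1 - cy) <= 2 * C * (e / 16 / C1) by rewrite ler_wpM2l// mulr_ge0.
have k3 : C * (e / 16 / C1) <= e / 16.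
  by rewrite mulrA ler_pdivrMr// mulrC ler_wpM2l ?ltW// /C1; lra.
have -> : u - v = (u - u1) + ((u1 - v1) - (v - v1)) by ring.
apply: le_trans (ler_normD _ _) _.
have := ler_normB (u1 - v1) (v - v1).
by lra.
Qed.

End strong_limit.

Theorem theorem2 (R : realType)
    (d : measure_display) (Omega : measurableType d) (P : probability Omega R)
    (T : Omega -> Omega)
    (P_nonatomic : nonatomic P)
    (T_mp : measure_preserving P T)
    (T_ergodic : ergodic P T)
    (d' : measure_display) (Omega' : measurableType d')
    (P' : probability Omega' R) (Y : {RV P' >-> R})
    (Y_gt0 : forall w : Omega', 0 < Y w) :
  exists (b : R -> R) (f : Omega -> R),
    [/\ (forall t : R, 0 < t -> 0 < b t),
        regularly_varying 1 b,
        convex_function (`]0, +oo[%classic : set R) b,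
        measurable_fun [set: Omega] f /\ (forall w : Omega, 0 < f w) &
        strongly_cvg_in_distribution P (Z := R^o) `]0, +oo[
          (fun (n : nat) (w : Omega) =>
             (b n%:R)^-1 * \sum_(0 <= k < n) f (iter k T w))
          P' Y].
Proof.
have Y_ge0 w : 0 <= Y w by exact: ltW.
have mY : measurable_fun [set: Omega'] (Y : Omega' -> R) by exact: measurable_funPT.
have [V HV] := indep_sequence P_nonatomic T_mp T_ergodic persistence (tol_gt0 R)
  (fun i v _ => law_ge0 P' Y i v) (law_sum P' mY Y_ge0).
have /choice[r Hr] : forall j, exists r : Omega -> nat,
    [/\ measurable_fun [set: Omega] r,
        forall x, (0 < r x)%N -> r (T x) = (r x).-1 &
        prob P [set x | r x = 0%N] <= sparsity R j].
  move=> j; apply: (hitting_time T_mp T_ergodic P_nonatomic).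
  by rewrite divr_gt0 ?exprn_gt0 ?ltr0n ?scale_gt0.
have mr j : measurable_fun [set: Omega] (r j) by have [] := Hr j.
have rT j x : (0 < r j x)%N -> r j (T x) = (r j x).-1 by have [_ + _] := Hr j; apply.
have r0 j : prob P [set x | r j x = 0%N] <= sparsity R j by have [] := Hr j.
have D0 j x : 0 <= level_value R V j x by have /andP[] := renewal_value_bound HV (stage j) x.
pose f := density r (level_value R V).
have f0 x : 0 < f x by exact: density_gt0.
exists (@norming R), f; split.
- exact: norming_gt0.
- exact: norming_regular.
- exact: norming_convex.
- split => //; apply: measurable_density => // j.
  exact: (measurable_renewed HV).
move=> Q QP g cg [M0 [_ gM]].
pose D : set R := `]0, +oo[%classic.
have mD : measurable D by exact: measurable_itv.
pose C := `|M0| + 1.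
have gC z : D z -> `|g z| <= C.
  by move=> Dz; apply: (gM C) => //; rewrite /C (le_lt_trans (ler_norm M0))// ltrDl.
(* Extension by 0: nothing is known of [g] outside the half-line, not even measurability. *)
pose g' : R -> R := g \_ D.
have g'E z : 0 < z -> g' z = g z.
  by move=> z0; rewrite /g' patchE mem_set// /D /= in_itv/= z0.
have g'C z : `|g' z| <= C.
  rewrite /g' patchE; case: ifPn => [/set_mem|_]; first exact: gC.
  by rewrite normr0 addr_ge0.
have mg' : measurable_fun [set: R] g'.
  apply/(measurable_restrictT g mD).
  exact: subspace_continuous_measurable_fun.
have cg' x : 0 < x -> {for x, continuous g'}.
  move=> x0.
  have oD : open D by exact: interval_open.
  have Dx : D x by rewrite /D /= in_itv/= x0.
  have cgx : {for x, continuous g}.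
    by move: cg; rewrite continuous_open_subspace// => /(_ x); apply; exact/mem_set.
  rewrite /prop_for /continuous_at g'E//; apply: cvg_trans cgx.
  have nD : nbhs x D by apply: open_nbhs_nbhs; split.
  apply: near_eq_cvg; apply: filterS nD => y Dy.
  by rewrite g'E//; move: Dy; rewrite /D /= in_itv/= andbT.
have mF := measurable_normed_sum T_mp HV mr.
have lim := strong_limit mY Y_gt0 QP mF
  (fun g C mg gC ug h e => @weighted_limit _ _ _ _ _ T_mp _ _ _ _ mY Y_ge0 _ _ HV mr rT r0 T_ergodic g C mg gC ug h e)
  mg' g'C cg'.
have F0 n w : (0 < n)%N -> 0 < normed_sum R T V r n w.
  move=> n0; rewrite mulr_gt0// ?invr_gt0 ?norming_gt0 ?ltr0n//.
  by rewrite big_ltn// ltr_pwDl// sumr_ge0// => i _; exact: ltW.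
have -> : ('E_P'[g \o Y])%E = (mean P' (fun w => g' (Y w)))%:E.
  have bY : bdd_meas (fun w => g' (Y w)).
    by split; [exact: measurableT_comp|exists C].
  rewrite unlock /mean /Rintegral fineK; last exact/integrable_fin_num/bdd_measW.
  by apply: eq_integral => w _; rewrite g'E.
apply: (@cvg_trans _ ((mean Q (fun x => g' (normed_sum R T V r n x)))%:E @[n --> \oo])).
  apply: near_eq_cvg; near=> n.
  (* For [n = 0] the sum is empty and the normed sum is 0, outside the half-line, where [g] and [g']
     may differ. *)
  have n0 : (0 < n)%N by near: n; exact: nbhs_infty_gt.
  have bF : bdd_meas (fun x => g' (normed_sum R T V r n x)).
    by split; [exact: (measurableT_comp mg' (mF n))|exists C].
  rewrite /mean /Rintegral fineK; last exact/integrable_fin_num/bdd_measW.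
  by apply: eq_integral => w _; rewrite g'E// F0.
apply: cvg_EFin; first by near=> n.
apply/cvgrPdist_le => e /lim[N HN]; exists N => // n /= /HN.
by rewrite distrC.
Unshelve. all: by end_near. Qed.
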